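(* Let $\mathcal P_4$ be the family of all 3-uniform minimal 4-paths. For every integer $n\ge 1$, the Turán number $\mathrm{ex}_3(n;\mathcal P_4)$ and the family $\mathrm{Ex}_3(n;\mathcal P_4)$ of extremal 3-graphs (up to isomorphism) are as follows: \begin{itemize} \item for $n\le 6$: $\mathrm{ex}_3(n;\mathcal P_4)=\binom n3$ and $\mathrm{Ex}_3(n;\mathcal P_4)=\{K_n^{(3)}\}$; \item for $n=7$: $\mathrm{ex}_3(n;\mathcal P_4)=20$ and $\mathrm{Ex}_3(n;\mathcal P_4)=\{K_6^{(3)}\cup K_1\}$; \item for $n=8$: $\mathrm{ex}_3(n;\mathcal P_4)=22$ and $\mathrm{Ex}_3(n;\mathcal P_4)=\{S_8^{+1},SP_8,SK_8\}$; \item for $n\ge 9$: $\mathrm{ex}_3(n;\mathcal P_4)=\binom{n-1}2+1$ and $\mathrm{Ex}_3(n;\mathcal P_4)=\{S_n^{+1}\}$. \end{itemize}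
   Context: A 3-graph $H$ consists of a finite vertex set $V(H)$ and a set $E(H)\subseteq\binom{V(H)}3$ of edges. A (3-uniform) minimal 4-path is a 3-graph (without isolated vertices) with edge set $\{a_0,a_1,a_2,a_3\}$ such that $a_i\cap a_j\ne\emptyset$ if and only if $|i-j|\le 1$; $\mathcal P_4$ is the family of all of them. For a family $\mathcal F$ of 3-graphs, $H$ is $\mathcal F$-free if no sub-3-graph of $H$ is isomorphic to a member of $\mathcal F$. $\mathrm{ex}_3(n;\mathcal F)$ is the maximum number of edges of an $\mathcal F$-free 3-graph on $n$ vertices, and $\mathrm{Ex}_3(n;\mathcal F)$ is the family (up to isomorphism) of all $n$-vertex $\mathcal F$-free 3-graphs with exactly $\mathrm{ex}_3(n;\mathcal F)$ edges. Special 3-graphs. $K_n^{(3)}$ is the complete 3-graph on $n$ vertices; $K_6^{(3)}\cup K_1$ is $K_6^{(3)}$ together with one isolated vertex. The full star $S_n$ is the 3-graph on $n$ vertices consisting of all triples containing a fixed vertex (the center); the starplus $S_n^{+1}$ is obtained from $S_n$ by adding one extra edge (not containing the center). For a 3-graph $F$ with vertex set $V(F)$, the $F$-star $SF_n$ is the 3-graph on a vertex set $V\supset V(F)$ with $|V|=n$, with a distinguished vertex $v\in V\setminus V(F)$, whose edges are the edges of $F$ together with all triples of $V$ that contain $v$ and at least one vertex of $V(F)$. $SP_n$ is the $F$-star with $F=P$, the 5-vertex 3-graph consisting of two edges sharing exactly one vertex; $SK_n$ is the $F$-star with $F=K=K_4^{(3)}$, the complete 3-graph on four vertices. *)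

(* Defs.v *)
From mathcomp Require Import all_boot.
From mathcomp Require Export boolp.

Set Implicit Arguments.
Unset Strict Implicit.
Unset Printing Implicit Defensive.

Definition triples (V : finType) : {set {set V}} := [set e : {set V} | #|e| == 3].

(* A 3-graph whose vertex set is the whole finite type V. *)
Definition graph3 (V : finType) := {E : {set {set V}} | E \subset triples V}.

Definition Graph3 (V : finType) (E : {set {set V}}) (E3 : E \subset triples V) :
  graph3 V := exist _ E E3.

Definition edges (V : finType) (H : graph3 V) : {set {set V}} := val H.

Lemma triples_subset (V : finType) (P : pred {set V}) :
  [set e in triples V | P e] \subset triples V.
Proof. by apply/subsetP => e; rewrite inE => /andP[]. Qed.

(* The 3-graph on V whose edges are all the triples satisfying P. *)
Definition graph3_of (V : finType) (P : pred {set V}) : graph3 V :=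
  Graph3 (triples_subset P).

Definition iso3 (U V : finType) (G : graph3 U) (H : graph3 V) : Prop :=
  exists2 f : U -> V, bijective f &
    forall e : {set U}, (e \in edges G) = (f @: e \in edges H).

(* The sub-3-graph of H with vertex set W, whose edges are those edges of H
   that belong to D and are contained in W; every sub-3-graph of H is obtained
   in this way. *)
Definition sub3graph (V : finType) (H : graph3 V) (W : {set V})
    (D : {set {set V}}) : graph3 {x : V | x \in W} :=
  graph3_of (fun e => val @: e \in D :&: edges H).

Definition family3 := forall V : finType, graph3 V -> Prop.

Definition free3 (F : family3) (V : finType) (H : graph3 V) : Prop :=
  forall (W : {set V}) (D : {set {set V}}) (U : finType) (G : graph3 U),
    F U G -> ~ iso3 (sub3graph H W D) G.

(* Up to isomorphism, every n-vertex 3-graph has vertex set 'I_n. *)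
Definition ex3 (n : nat) (F : family3) : nat :=
  \max_(H : graph3 'I_n | `[< free3 F H >]) #|edges H|.

Definition Ex3 (n : nat) (F : family3) : family3 := fun V H =>
  [/\ #|V| = n, free3 F H & #|edges H| = ex3 n F].

(* The condition on intersections forces the four edges a i to be distinct. *)
Definition P4 : family3 := fun V H =>
  exists a : 'I_4 -> {set V},
    [/\ edges H = [set a i | i : 'I_4],
        forall i j : 'I_4,
          (a i :&: a j != set0) = ((i <= j.+1) && (j <= i.+1))
      & forall x : V, exists2 e, e \in edges H & x \in e].

Definition complete3 (n : nat) : graph3 'I_n := graph3_of predT.

Lemma add_isolated_subproof (V : finType) (G : graph3 V) :
  [set Some @: e | e : {set V} in edges G]
    \subset triples (option V).
Proof.
apply/subsetP => _ /imsetP[e Ge ->]; rewrite inE card_imset; last exact: Some_inj.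
by have /subsetP/(_ _ Ge) := valP G; rewrite inE.
Qed.

Definition add_isolated (V : finType) (G : graph3 V) : graph3 (option V) :=
  Graph3 (add_isolated_subproof G).

(* The center is the vertex 0. *)
Definition star (n : nat) : graph3 'I_n :=
  graph3_of (fun e => [exists x in e, val x == 0]).

(* The extra edge is {1, 2, 3}; this is a starplus for n >= 4. *)
Definition starplus (n : nat) : graph3 'I_n :=
  graph3_of (fun e => (e \in edges (star n)) || (e == [set x : 'I_n | 1 <= x <= 3])).

(* The F-star on n > #|U| vertices: the distinguished vertex v is None, the
   vertices of F are the Some (inl u), and the n - #|U| - 1 other vertices are
   the Some (inr i). *)
Definition Fstar (U : finType) (F : graph3 U) (n : nat) :
    graph3 (option (U + 'I_(n - #|U| - 1))) :=
  graph3_of (fun e =>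
    (e \in [set [set Some (inl u) | u in f] | f : {set U} in edges F])
    || ((None \in e) && [exists u, Some (inl u) \in e])).

(* The edges {0, 1, 2} and {2, 3, 4} on the vertices 0, ..., 4. *)
Definition P : graph3 'I_5 :=
  graph3_of (fun e => (e == [set x : 'I_5 | x <= 2]) || (e == [set x : 'I_5 | 2 <= x])).

Definition SP (n : nat) := Fstar P n.

Definition SK (n : nat) := Fstar (complete3 4) n.

(* Main.v *)
(* A 3-graph contains no minimal 4-path iff its intersection graph (vertices: the
   edges; adjacency: having a common vertex) has no induced path on four vertices,
   that is, iff this intersection graph is a cograph.  By Seinsche's theorem a
   non-intersecting such 3-graph E then contains two nonempty vertex-disjoint parts
   D1 and D2 all of whose edges are met by every other edge of E.  For n >= 11 this
   yields a vertex of degree at most n - 2 as soon as E has more than C(n-1,2)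
   edges: every edge outside D1 and D2 has exactly one vertex in one of the two
   parts, and this vertex is then common to all edges of that part.  (If E is
   intersecting without a common vertex, a vertex outside four suitable edges has
   degree at most 7, the number of pairs meeting all four.)  Deleting the vertex of
   low degree gives an induction on n, in which the starplus on n - 1
   vertices extends only to the starplus on n vertices.  The cases 7 <= n <= 10 are
   settled by search trees found by computer, and for n <= 6 there is no room for a minimal
   4-path. *)

Require Import Defs.
From mathcomp Require Import all_boot.
From mathcomp Require Import zify.

Set Implicit Arguments.
Unset Strict Implicit.
Unset Printing Implicit Defensive.

(** The degree bound n - 2 is the increment C(n-1,2) - C(n-2,2), so deleting such a vertex keeps the
    number of edges above the threshold. Degree counting does not settle one situation: the two
    parts exhaust the vertices and neither has a common vertex. Then no edge lies across, and E is a
    union of two path-free sets on a and b vertices with a + b = n. Strong induction bounds them by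
    C(a-1,2) + 10 and C(b-1,2) + 10, which add up to at most C(n-1,2). The surplus 10 is that of the
    complete 3-graph on six vertices, and because of it the orders below 9, where the starplus need
    not be extremal, enter the induction for large n. For the same reason the classification is
    stated for subsets [W] of one fixed type. The threshold 11 has two sources: a vertex outside
    both parts has degree up to 3 * 3 = 9, which must not exceed n - 2, and beside a part that is a
    single edge the other part must have at least 8 vertices. For 7 to 10 vertices there are two
    search trees each, one for sets containing the disjoint triples 012 and 345, one refuting large
    intersecting sets. *)

Section Paths.
Variable V : finType.
Implicit Types (d e : {set V}) (E : {set {set V}}).

Definition meets d e := d :&: e != set0.

Definition path4 a b c d :=
  [&& meets a b, meets b c, meets c d, ~~ meets a c, ~~ meets a d & ~~ meets b d].

Definition P4free E :=
  forall a b c d, a \in E -> b \in E -> c \in E -> d \in E -> ~~ path4 a b c d.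

Lemma meetsC d e : meets d e = meets e d.
Proof. by rewrite /meets setIC. Qed.

Lemma meetsP d e : reflect (exists2 x, x \in d & x \in e) (meets d e).
Proof.
rewrite /meets; apply: (iffP (set0Pn _)) => [[x]|[x dx ex]]; first by rewrite inE => /andP[]; exists x.
by exists x; rewrite inE dx.
Qed.

Lemma P4freeS E E' : E' \subset E -> P4free E -> P4free E'.
Proof. by move=> /subsetP s F a b c d /s ? /s ? /s ? /s ?; apply: F. Qed.
End Paths.

Lemma meets_imset (U V : finType) (f : U -> V) (d e : {set U}) :
  injective f -> meets (f @: d) (f @: e) = meets d e.
Proof. by move=> fI; rewrite /meets -imsetI ?imset_eq0 //; move=> x y _ _; apply: fI. Qed.

Lemma path4_imset (U V : finType) (f : U -> V) (a b c d : {set U}) :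
  injective f -> path4 (f @: a) (f @: b) (f @: c) (f @: d) = path4 a b c d.
Proof. by move=> fI; rewrite /path4 !meets_imset. Qed.

Lemma edges_card (V : finType) (H : graph3 V) e : e \in edges H -> #|e| = 3.
Proof. by move=> eH; have /subsetP/(_ _ eH) := valP H; rewrite inE => /eqP. Qed.

Lemma edgesE (V : finType) (P : pred {set V}) e :
  (e \in edges (graph3_of P)) = (#|e| == 3) && P e.
Proof. by rewrite /edges /= !inE. Qed.

(** Four edges forming a path, taken as a sub-3-graph on their union, leave no vertex isolated and
    so give a member of [P4]. Conversely, the inverse of an isomorphism followed by the inclusion of
    the vertex set is injective and carries a path back to edges of [H]. *)
Lemma free3P (V : finType) (H : graph3 V) : free3 P4 H <-> P4free (edges H).
Proof.
split=> [F a b c d aH bH cH dH|F W D U G [a [aG aI aC]] [f fB fE]].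
  apply/negP => /and5P[ab bc cd ac /andP[ad bd]].
  pose W := a :|: b :|: c :|: d.
  pose s := [:: a; b; c; d].
  pose D := [set e in s].
  pose G := sub3graph H W D.
  have sD i : i < 4 -> nth a s i \in D by move=> li; rewrite inE mem_nth.
  have sH e : e \in D -> e \in edges H.
    by rewrite !inE => /or4P[]/eqP->.
  have sW e : e \in D -> e \subset W.
    by rewrite !inE => /or4P[]/eqP->; apply/subsetP => x xe; rewrite !inE xe ?orbT.
  pose l (e : {set V}) : {set {x : V | x \in W}} := [set x | val x \in e].
  have lK e : e \in D -> val @: l e = e.
    move=> eD; apply/setP => x; apply/imsetP/idP => [[y + ->]|xe]; first by rewrite inE.
    by exists (Sub x (subsetP (sW e eD) x xe)); rewrite ?inE ?SubK.
  have valI : injective (val : {x : V | x \in W} -> V) by exact: val_inj.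
  have lG e : (e \in edges G) = (val @: e \in D).
    rewrite edgesE -(card_imset (mem e) valI).
    apply/andP/idP => [[_ /setIP[]]|eD] //.
    by rewrite in_setI eD (edges_card (sH _ eD)) sH.
  apply: (F W D _ G); last by exists id; [exists id | move=> e; rewrite imset_id].
  exists (fun i : 'I_4 => l (nth a s i)); split.
  - apply/setP => e; rewrite lG; apply/idP/imsetP => [|[i _ ->]]; last by rewrite lK sD.
    rewrite inE => /(nthP a)[i li ie]; exists (Ordinal li) => //=.
    by apply: (imset_inj valI); rewrite lK ?sD.
  - move=> i j; rewrite -/(meets _ _) -(meets_imset _ _ valI) !lK ?sD //.
    (* The diagonal case i = j demands that each edge is nonempty, which [path4] does not record. *)
    have rf e : e \in D -> meets e e.
      move=> /sH/edges_card e3; apply/meetsP; have /card_gt0P[x] : 0 < #|e| by rewrite e3.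
      by exists x.
    case: i j => [[|[|[|[|i]]]] //= Hi] [[|[|[|[|j]]]] //= Hj]; rewrite ?rf ?inE ?eqxx ?orbT //;
    by rewrite ?[meets b a]meetsC ?[meets c a]meetsC ?[meets d a]meetsC ?[meets c b]meetsC
               ?[meets d b]meetsC ?[meets d c]meetsC ?ab ?bc ?cd ?(negbTE ac) ?(negbTE ad) ?(negbTE bd).
  - move=> [x Wx].
    have ex e : e \in D -> x \in e -> exists2 e0, e0 \in edges G & Sub x Wx \in e0.
      by move=> eD xe; exists (l e); rewrite ?lG ?lK // inE SubK.
    have : [|| x \in a, x \in b, x \in c | x \in d] by rewrite -!in_setU !setUA.
    by case/or4P; apply: ex; rewrite !inE eqxx ?orbT.
have [g fK gK] := fB.
have gI := can_inj gK.
pose b i := val @: (g @: a i).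
have valI : injective (val : {x : V | x \in W} -> V) by exact: val_inj.
have bH i : b i \in edges H.
  have : g @: a i \in edges (sub3graph H W D).
    by rewrite fE -imset_comp (eq_imset _ gK) imset_id aG imset_f.
  by rewrite edgesE => /andP[_ /setIP[]].
have bI i j : meets (b i) (b j) = (i <= j.+1) && (j <= i.+1).
  by rewrite !meets_imset // -aI.
have := F _ _ _ _ (bH (@Ordinal 4 0 isT)) (bH (@Ordinal 4 1 isT))
             (bH (@Ordinal 4 2 isT)) (bH (@Ordinal 4 3 isT)).
by rewrite /path4 !bI.
Qed.

(** * Search certificates *)

(** Decimal numerals keep their leading zeros, and with at most ten vertices each vertex is one
    digit. So a numeral is a compact list of vertices, read as one triple or a permutation by
    [decode] and as a list of triples by [decode3]. *)
Fixpoint digits (u : Decimal.uint) : seq nat :=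
  match u with
  | Decimal.Nil => [::]
  | Decimal.D0 u => 0 :: digits u | Decimal.D1 u => 1 :: digits u
  | Decimal.D2 u => 2 :: digits u | Decimal.D3 u => 3 :: digits u
  | Decimal.D4 u => 4 :: digits u | Decimal.D5 u => 5 :: digits u
  | Decimal.D6 u => 6 :: digits u | Decimal.D7 u => 7 :: digits u
  | Decimal.D8 u => 8 :: digits u | Decimal.D9 u => 9 :: digits u
  end.

Definition decode (u : Number.uint) : seq nat :=
  if u is Number.UIntDecimal u then digits u else [::].

Fixpoint chop (s : seq nat) : seq (seq nat) :=
  if s is i :: j :: k :: s' then [:: i; j; k] :: chop s' else [::].

Definition decode3 u := chop (decode u).

(* A search tree for the 3-graphs with at least K edges among the triples [al], with
   all triples of [inn] as edges, that contain no obstruction.  Numerals list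
   vertices digit by digit: 012034 stands for the triples {0,1,2}, {0,3,4}.
   - [Bound]: disjoint (up to [inn]) obstructions, each of which excludes a triple
     of [al]; there are too many of them for K edges to remain.
   - [Final]: [al] has at most K triples left and is a relabelled target.
   - [Force]: obstructions with a single triple outside [inn], which is discarded.
   - [Branch x c1 ps c2]: [c1] treats the graphs containing [x]; the permutations
     [ps] preserve [inn] and [al], so that in [c2] the images of [x] under them
     may be discarded together with [x]. *)
Inductive cert :=
  | Bound of seq Number.uint
  | Final of Number.uint
  | Force of seq Number.uint & cert
  | Branch of Number.uint & cert & seq Number.uint & cert.

Definition all_triples n :=
  [seq c <- [seq [:: ij.1; ij.2; k] | ij <- [seq (i, j) | i <- iota 0 n, j <- iota 0 n],
                                      k <- iota 0 n] | sorted ltn c].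

Section Check.
Variables (n K : nat) (obs : pred (seq (seq nat))) (targets : seq (seq (seq nat))).

Definition wf (c : seq nat) := all (fun i => i < n) c.

(** Filtering [iota] returns the image as an increasing list, the form in which [all_triples] lists
    triples, so triples can be compared as lists. *)
Definition relabel (p c : seq nat) := [seq i <- iota 0 n | i \in map (nth 0 p) c].

Definition is_perm p := perm_eq p (iota 0 n).

(** Among the triples that an obstruction takes out of [al] at least one is not an edge; this is the
    predecessor in the new value of [K']. An obstruction consisting of known edges is a
    contradiction and ends the list. *)
Fixpoint bound_ok (inn al : seq (seq nat)) K' (ps : seq Number.uint) :=
  (size al < K') ||
  if ps is p :: ps' then
    let p := decode3 p in
    let r := [seq c <- p | c \notin inn] in
    let al' := [seq c <- al | c \notin r] in
    [&& obs p, all (mem al) r & nilp r || bound_ok inn al' (K' - (size al - size al').-1) ps']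
  else false.

Fixpoint force (inn al : seq (seq nat)) (ps : seq Number.uint) :=
  if ps is p :: ps' then
    let p := decode3 p in
    if (obs p, [seq c <- p | c \notin inn]) is (true, [:: x])
    then force inn [seq c <- al | c != x] ps' else force inn al ps'
  else al.

(** Two one-sided conditions suffice: known edges go to known edges, and every allowed triple is the
    image of an allowed one. A listed permutation that fails is skipped by [check], not rejected. *)
Definition symmetry (inn al : seq (seq nat)) (p : seq nat) :=
  [&& is_perm p, all (mem inn) (map (relabel p) inn) & all (mem (map (relabel p) al)) al].

Fixpoint check (inn al : seq (seq nat)) (ct : cert) :=
  match ct with
  | Bound ps => bound_ok inn al K ps
  | Final p => 
      let p := decode p in
      [&& size al <= K, is_perm p &
        has (fun t => let t' := map (relabel p) t in [&& all wf t, all (mem t') al & all (mem al) t'])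
          targets]
  | Force ps ct => check inn (force inn al ps) ct
  | Branch x c1 ps c2 => 
      let x := decode x in
      let ys := x :: [seq relabel p x | p <- map decode ps & symmetry inn al p] in
      [&& wf x, check (x :: inn) al c1 & check inn [seq c <- al | c \notin ys] c2]
  end.

Variables (V : finType) (x0 : V) (E : {set {set V}}).

Definition place (s : seq V) (c : seq nat) : {set V} := [set x in map (nth x0 s) c].

Definition labelling (W : {set V}) s := [/\ uniq s, size s = n & s =i W].

Lemma placeP s c x : reflect (exists2 i, i \in c & x = nth x0 s i) (x \in place s c).
Proof. by rewrite inE; apply: mapP. Qed.

Lemma is_perm_lt p i : is_perm p -> i < n -> nth 0 p i < n.
Proof.
move=> pp li; have := perm_mem pp (nth 0 p i).
by rewrite mem_iota add0n /= => <-; rewrite mem_nth // (perm_size pp) size_iota.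
Qed.

(** Moving a triple by [p] has the same effect as permuting the labels by [p]; this turns a symmetry
    of the search state into a change of labelling. *)
Lemma place_relabel s p c : size s = n -> is_perm p -> wf c ->
  place s (relabel p c) = place (map (nth x0 s) p) c.
Proof.
move=> ss pp /allP wc; have sp : size p = n by rewrite (perm_size pp) size_iota.
apply/setP => x; apply/placeP/placeP => -[i].
  rewrite mem_filter => /andP[/mapP[j jc ->]] _ ->; exists j => //.
  by rewrite (nth_map 0) // sp wc.
move=> ic ->; exists (nth 0 p i); last by rewrite (nth_map 0) // sp wc.
by rewrite mem_filter map_f //= mem_iota is_perm_lt ?wc.
Qed.

Lemma labelling_relabel W s p : labelling W s -> is_perm p ->
  labelling W (map (nth x0 s) p).
Proof.
move=> [us ss sW] pp.
have pe : perm_eq (map (nth x0 s) p) s.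
  by rewrite (perm_trans (perm_map _ pp)) // -ss map_nth_iota0 // take_size.
split; first by rewrite (perm_uniq pe).
  by rewrite size_map (perm_size pp) size_iota.
by move=> x; rewrite (perm_mem pe).
Qed.

Definition models s t := forall e, (e \in E) = (e \in map (place s) t).

Lemma count_le_card s al : (forall e, e \in E -> e \in map (place s) al) ->
  #|E| <= count (fun c => place s c \in E) al.
Proof.
move=> sE; rewrite -size_filter -(size_map (place s)).
apply: leq_trans (card_size _); apply/subset_leq_card/subsetP => e eE.
have /mapP[c cal ee] := sE e eE.
by rewrite ee map_f // mem_filter -ee eE.
Qed.

(** The labelling is quantified here because a branch of the search tree may replace the current
    one. *)
Hypothesis obsP : forall W s p, labelling W s -> obs p ->
  exists2 c, c \in p & place s c \notin E.

Lemma bound_sound W s inn ps al K' : labelling W s ->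
  (forall c, c \in inn -> place s c \in E) -> bound_ok inn al K' ps ->
  count (fun c => place s c \in E) al < K'.
Proof.
move=> lab innE; elim: ps al K' => [|p ps IH] al K' /=.
  by rewrite orbF; apply: leq_trans; rewrite ltnS count_size.
case/orP; first by apply: leq_trans; rewrite ltnS count_size.
set r := [seq c <- _ | _]; set al' := [seq c <- al | _] => /and3P[op /allP rs].
have [c cp cE] := obsP lab op.
have cr : c \in r by rewrite mem_filter cp andbT; apply: contra cE => /innE.
have cal : c \in al := rs c cr.
have -> : nilp r = false by case: (r) cr.
move/IH.
set P := (X in count X al).
pose a := mem r.
have split Q : count Q al = count Q (filter a al) + count Q al'.
  by rewrite -count_cat; apply/esym/permP; rewrite perm_filterC.
(* The missing triple [c] is among the removed ones, so they contribute at least one edge less than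
   their number. *)
have lt1 : count P (filter a al) < size (filter a al).
  rewrite -(count_predC P (filter a al)) -[X in X < _]addn0 ltn_add2l -has_count.
  by apply/hasP; exists c => //; rewrite mem_filter /= cr cal.
have := split predT; rewrite (split P) !count_predT => sz lt2.
have arith i j k l m : i < j -> k = j + l -> m < K' - (k - l).-1 -> i + m < K' by lia.
exact: arith lt1 sz lt2.
Qed.

Lemma force_sound W s inn ps al : labelling W s ->
  (forall c, c \in inn -> place s c \in E) ->
  (forall e, e \in E -> e \in map (place s) al) ->
  forall e, e \in E -> e \in map (place s) (force inn al ps).
Proof.
move=> lab innE; elim: ps al => [|p ps IH] al //= sE.
case op: (obs _) => /=; last exact: IH.
case er: [seq c <- _ | _] => [|x [|y r]]; try exact: IH.
apply: IH => e eE; have /mapP[c cal ec] := sE e eE.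
rewrite ec map_f // mem_filter cal andbT; apply/eqP => cx.
have [c' c'p c'E] := obsP lab op.
have : c' \in [:: x] by rewrite -er mem_filter c'p andbT; apply: contra c'E => /innE.
by rewrite inE -cx => /eqP cc; rewrite cc -ec eE in c'E.
Qed.

(** Induction on the tree with the labelling kept general. Branches and leaves may renumber the
    vertices, so the target is reached for some labelling [s'] of [W], not for [s] itself. *)
Lemma check_sound W s inn al ct :
  all wf inn -> all wf al -> labelling W s ->
  (forall c, c \in inn -> place s c \in E) ->
  (forall e, e \in E -> e \in map (place s) al) -> K <= #|E| ->
  check inn al ct ->
  exists s' t, [/\ labelling W s', t \in targets & models s' t].
Proof.
elim: ct inn al s => [ps|p|ps ct IH|x c1 IH1 ps c2 IH2] inn al s winn wal lab innE sE KE.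
- by move/(bound_sound lab innE); have := count_le_card sE; lia.
- move=> /= /and3P[szal pp /hasP[t tT /and3P[wt /allP alt /allP tal]]].
  have lab' := labelling_relabel lab pp.
  have sn : size s = n by case: lab.
  exists (map (nth x0 s) (decode p)), t; split=> // e; apply/idP/mapP => [/sE/mapP[c cal ->]|[c ct ->]].
    have /mapP[c' c't ->] := alt c cal; exists c' => //.
    by rewrite place_relabel // (allP wt).
  rewrite -place_relabel // ?(allP wt) //.
  have cal : relabel (decode p) c \in al := tal _ (map_f _ ct).
  (* All of [al] must be edges: one missing triple would leave fewer than [size al], hence fewer
     than [K], edges. *)
  case: (boolP (_ \in E)) => // cE.
  have := count_le_card sE.
  have : count (fun c => place s c \in E) al < size al.
    rewrite -(count_predC (fun c => place s c \in E) al) -[X in X < _]addn0 ltn_add2l -has_count.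
    by apply/hasP; exists (relabel (decode p) c).
  lia.
- have wf' : all wf (force inn al ps).
    elim: ps al wal {IH sE} => [|q ps IHp] al wal //=.
    case: (obs _) => //=; last exact: IHp.
    case _ : [seq c <- _ | _] => [|y [|z r]]; try exact: IHp.
    by apply: IHp; apply/allP => c; rewrite mem_filter => /andP[_ /(allP wal)].
  by move=> chk; apply: (IH inn _ s winn wf' lab innE _ KE chk); apply: (force_sound ps lab innE sE).
move=> /= /and3P[wx ch1 ch2].
set x' := decode x in wx ch1 ch2; set ys := _ :: _ in ch2.
have sn : size s = n by case: lab.
(* Either no image of the branching triple is an edge and all of them are discarded, or one is, and
   the symmetry producing it gives a labelling in which the branching triple itself is an edge. *)
case: (boolP (has (fun y => place s y \in E) ys)) => [/hasP[y yys yE]|/hasPn noy]; last first.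
  apply: (IH2 _ _ s) ch2 => //; first by apply/allP => c; rewrite mem_filter => /andP[_ /(allP wal)].
  move=> e eE; have /mapP[c cal ec] := sE e eE.
  by rewrite ec map_f // mem_filter cal andbT; apply/negP => /noy; rewrite -ec eE.
have {yys} [s' [lab' xE innE' sE']] : exists s', [/\ labelling W s', place s' x' \in E,
    forall c, c \in inn -> place s' c \in E & forall e, e \in E -> e \in map (place s') al].
  move: yys; rewrite inE => /predU1P[ey|]; first by exists s; split=> //; rewrite -ey.
  case/mapP => p; rewrite mem_filter => /andP[/and3P[pp /allP pinn /allP pal] _] ey.
  exists (map (nth x0 s) p); split; first exact: labelling_relabel.
  + by rewrite -place_relabel // -ey.
  + by move=> c ci; rewrite -place_relabel ?(allP winn) //; apply/innE/pinn/map_f.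
  move=> e /sE/mapP[c cal ->]; have /mapP[c' c'al ->] := pal c cal.
  by rewrite place_relabel ?(allP wal) // map_f.
apply: (IH1 (x' :: inn) al s') ch1 => //=; first by rewrite wx.
by move=> c; rewrite inE => /predU1P[->|/innE'].
Qed.

Lemma all_triplesP W s (e : {set V}) : labelling W s -> e \subset W -> #|e| = 3 ->
  e \in map (place s) (all_triples n).
Proof.
move=> [us sn sW] /subsetP eW e3.
pose c := [seq i <- iota 0 n | nth x0 s i \in e].
have pc : place s c = e.
  apply/setP => x; apply/placeP/idP => [[i]|xe]; first by rewrite mem_filter => /andP[? _] ->.
  have xs : x \in s by rewrite sW eW.
  by exists (index x s); rewrite ?nth_index // mem_filter nth_index // xe mem_iota -sn index_mem.
have sc : size c = 3.
  rewrite -e3 -pc /place cardsE -(size_map (nth x0 s)); apply/esym/card_uniqP.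
  rewrite map_inj_in_uniq ?filter_uniq ?iota_uniq // => i j.
  rewrite !mem_filter !mem_iota !add0n /= -!sn => /andP[_ li] /andP[_ lj] eq.
  by apply/eqP; rewrite -(nth_uniq x0 li lj us) eq.
rewrite -pc map_f // mem_filter; apply/andP; split.
  exact/sorted_filter/iota_ltn_sorted/ltn_trans.
have : all (fun i => i < n) c by apply/allP => i; rewrite mem_filter mem_iota => /andP[_].
move: c sc {pc} => [|i [|j [|k [|l c]]]] //= _ /and4P[li lj lk _].
by apply/allpairsP; exists ((i, j), k); rewrite allpairs_f ?mem_iota.
Qed.

End Check.

Definition share (c d : seq nat) := has (mem c) d.

Definition path_obs n (p : seq (seq nat)) :=
  if p is [:: a; b; c; d] then
    all (wf n) p &&
    [&& share a b, share b c, share c d, ~~ share a c, ~~ share a d & ~~ share b d]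
  else false.

Definition disjoint_obs n (p : seq (seq nat)) :=
  if p is [:: a; b] then all (wf n) p && ~~ share a b else false.

(** Read with seven labels: the label 6 occurs in no triple and is the isolated vertex. *)
Definition clique_plus_point : seq (seq nat) := all_triples 6.

Definition starplus_triples n :=
  [seq c : seq nat <- all_triples n | (0 \in c) || (c == [:: 1; 2; 3])].

(** The label 0 is the distinguished vertex and 1 to [k] are the vertices of the 3-graph, whose
    triples [F] are given in these shifted labels. *)
Definition Fstar_triples (F : seq (seq nat)) k n :=
  [seq c : seq nat <- all_triples n | (c \in F) || (0 \in c) && has (fun i => 0 < i <= k) c].

Definition SP_triples := Fstar_triples [:: [:: 1; 2; 3]; [:: 3; 4; 5]] 5 8.

Definition SK_triples :=
  Fstar_triples [:: [:: 1; 2; 3]; [:: 1; 2; 4]; [:: 1; 3; 4]; [:: 2; 3; 4]] 4 8.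

(** * The search trees for 7 to 10 vertices *)

Section Certificates.
Local Open Scope dec_uint_scope.

(** Paths are written in order. With 126 added to the known 012 and 345, the numeral 126012045345 is
    the path 126, 012, 045, 345; its only triple not yet known is 045, which [Force] discards. *)
Definition cert_paths7 : cert :=
  Branch 126 (Force [:: 126012045345; 012126346345; 012126356345; 012126456345; 126012034345;
  126012035345] (Branch 016 (Force [:: 016012234345; 016012235345; 016012245345] (Branch 026
  (Force [:: 026012134345; 026012135345; 026012145345] (Branch 013 (Branch 256 (Bound [::
  014013236256; 013015256246; 024023136156; 036056125124]) [:: 0123546] (Bound [:: 024023136156;
  036056125124])) [:: 0124356; 0125346] (Bound [:: 024023136156]))) [::] (Branch 145 (Branch 023
  (Bound [:: 145014023236; 023024145156; 023025145146; 036023124145; 013015256246; 056046134123])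
  [::] (Branch 036 (Bound [:: 145014036236; 036056145124; 036046145125; 013015256246;
  025024134136]) [::] (Branch 236 (Bound [:: 014145256236; 015145246236; 025024134136;
  056046124123]) [::] (Bound [:: 013015256246; 025024134136; 056046124123])))) [:: 0124356;
  0125346] (Bound [:: 014013236256; 024023136156; 036056125124])))) [:: 0213456] (Branch 036
  (Branch 245 (Branch 013 (Bound [:: 036013124245; 036013125245; 036013145245; 013036246245;
  013036256245; 136013024245; 146014023235; 056025234134]) [::] (Branch 136 (Bound [::
  036136145245; 136036024245; 036136124245; 036136125245; 136036025245; 146014023235;
  015156236234]) [::] (Bound [:: 036023245145; 036056245124; 036046245125; 015014234236;
  025235134146; 024246156135]))) [:: 0213456] (Branch 046 (Branch 125 (Bound [:: 046036135125;
  046036235125; 046036123125; 036046124125; 014013236256; 156015023234]) [::] (Bound [::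
  135013046246; 014046236235; 056036134124; 156015023234; 025024146136])) [:: 0123546] (Branch 014
  (Branch 256 (Bound [:: 014013235256; 134014025256; 014015256236; 024023135156]) [::] (Bound [::
  146014023235; 015014234236; 135013024246])) [:: 0123546; 0213456; 0213546] (Bound [::])))) [::
  0124356; 0125346] (Branch 013 (Branch 256 (Bound [:: 014013235256; 013015256246; 013136256245;
  134013025256; 024023135156]) [:: 0123546] (Bound [:: 136013024245; 145014023236; 025235134146]))
  [:: 0124356; 0125346; 0213456; 0214356; 0215346] (Bound [::]))))) [:: 1023456; 2013456; 3450126;
  4350126; 5340126] (Branch 036 (Branch 245 (Branch 136 (Bound [:: 136036045245; 036136145245;
  136036024245; 036136124245; 036136125245; 136036025245; 013136246245; 146014023235;
  015156236234; 134034056256]) [::] (Branch 013 (Force [:: 036013124245; 036013125245;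
  036013145245; 013036246245; 013036256245] (Branch 146 (Bound [:: 146014023235; 025035134146;
  156015024234; 046045135123]) [:: 0123546] (Bound [:: 015014234236; 046024235135]))) [::] (Branch
  145 (Force [:: 036023245145; 036236245145] (Branch 125 (Force [:: 036034145125; 036046145125]
  (Branch 124 (Bound [:: 036056145124; 036035125124; 135015024246; 014146256235]) [::] (Bound [::
  135015024246; 014146256235; 056025234134]))) [:: 0123546] (Branch 056 (Branch 134 (Bound [::
  056025234134; 134034056256; 056045134123; 135015024246]) [::] (Bound [:: 015056246234;
  046056135123; 014146256235])) [:: 0123546] (Bound [:: 135015024246; 014146256235])))) [::]
  (Branch 125 (Force [:: 036034245125; 036046245125] (Branch 124 (Force [:: 036056245124;
  036035125124] (Branch 014 (Bound [:: 146014023235; 015014234236; 134014025256]) [::] (Bound [::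
  156015023234; 025235134146]))) [::] (Branch 015 (Branch 234 (Bound [:: 156015023234;
  015014234236; 056015134234; 015035234246]) [::] (Bound [:: 015014246236; 024023135156;
  025235134146])) [::] (Bound [:: 146014023235; 056025234134; 135035024246])))) [:: 0123546]
  (Branch 146 (Bound [:: 146014023235; 035015146246; 025056146134; 034024256156; 046045135123])
  [:: 0123546] (Bound [:: 015014234236; 046246235135; 134034056256])))))) [:: 0213456; 3450126;
  3540126] (Branch 256 (Branch 014 (Bound [:: 014013235256; 134014025256; 014045256236;
  034014156256; 135015024246; 056046234123]) [:: 3450126] (Bound [:: 013015256246; 034023256156;
  025024146136; 046045135123])) [:: 0123546; 0213456; 0213546] (Bound [:: 015014234236;
  025024134136]))) [:: 0124356; 0125346; 1023456; 1024356; 1025346; 2013456; 2014356; 2015346]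
  (Final 0123456)).
(** Nothing is known at the root, so every permutation is a symmetry and many images of 045 are
    discarded at once. An empty [Bound] passes when fewer than [K] triples are left. *)
Definition cert_intersecting7 : cert :=
  Branch 045 (Force [:: 045123; 045126; 045136; 045236] (Branch 124 (Bound [:: 035124; 036124;
  056124; 124356; 034125; 025134; 024135; 023145; 015234; 014235; 013245; 012345]) [:: 0123546;
  0132456; 0132546; 0162453; 0162543; 0231456; 0231546; 0261453; 0261543; 0361452; 0361542;
  4123056; 4132056; 4162053; 4231056; 4261053; 4361052] (Bound [::]))) [:: 0123465; 0123564;
  0124356; 0124365; 0125346; 0134256; 0134265; 0135246; 0145236; 0234156; 0234165; 0235146;
  0245136; 0345126; 1023456; 1023465; 1023564; 1024356; 1024365; 1025346; 1034256; 1034265;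
  1035246; 1045236; 2013456; 2013465; 2013564; 2014356; 2014365; 2015346; 3012456; 3012465;
  3012564; 4012563] (Bound [::]).
Definition cert_paths8 : cert :=
  Branch 016 (Force [:: 016012234345; 016012235345; 016012237345; 016012245345; 016012247345;
  016012257345; 012016346345; 012016356345; 012016567345; 012016367345; 012016456345;
  012016467345] (Branch 357 (Force [:: 012014345357; 012127357345; 016017357345; 012067357345;
  016024345357; 012167357345; 016046345357; 012267357345; 012146345357; 012124345357;
  012246345357; 012027357345] (Branch 026 (Bound [:: 026012134345; 026016147345; 026016137345;
  026016145345; 026012135345; 026016157345; 126012057357; 026023357457; 012015345347;
  045025123136; 034036156125]) [:: 10234567] (Branch 347 (Bound [:: 012015345347; 016025345347;
  016256357347; 012056345347; 012125345347; 012156357347; 012023345457; 057047134136;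
  045145123236]) [:: 01254367] (Branch 023 (Branch 147 (Bound [:: 147015023236; 025023134147;
  147034023256; 023037147156; 056023137147; 023035157147; 036023125147]) [::] (Branch 156 (Bound
  [:: 047023135156; 023037157156; 034023125156; 023236156145; 025056136137; 134013057256]) [::]
  (Bound [:: 145015023236; 034023125157; 025056136137; 134037057256; 047045135123]))) [::
  01254367; 10234567; 10254367] (Bound [:: 047145156236; 134037057256; 056035137147]))))) [::
  01235467; 01243567] (Branch 267 (Force [:: 267012013345; 267012014345; 267012134345;
  267012015345; 267012145345; 267012135345; 267012035345; 267012045345; 267012034345] (Branch 167
  (Bound [:: 167012023345; 167012025345; 167012024345; 017012236345; 026016147345; 067267124345;
  127016046345; 126167057345; 027012136345; 036246125157; 037047146156]) [:: 10234567] (Bound [::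
  017012236345; 026016147345; 127016046345; 126267057345; 027012136345; 025024146137;
  056037123124; 036246125157; 047023256156]))) [::] (Branch 026 (Force [:: 026012134345;
  026016147345; 026016137345; 026016145345; 026012135345; 026016157345] (Branch 126 (Bound [::
  126016045345; 126012034345; 126016047345; 126026035345; 126026057345; 126016037345;
  167012023345; 017012236345; 127016046345; 067012123345; 027012136345; 013014246256;
  036056125124]) [::] (Branch 167 (Bound [:: 167012023345; 167026024345; 167026025345;
  167012045345; 167026034345; 167026035345; 017012236345; 127016046345; 067012123345;
  027012136345; 013014246256; 037047146156]) [::] (Branch 127 (Bound [:: 127016045345;
  127012034345; 127016046345; 127016035345; 127012056345; 127016036345; 017012236345;
  027127156345; 067012123345; 025024146136; 013014246256]) [::] (Branch 017 (Force [::
  017012236345; 017012256345; 017026246345] (Branch 123 (Force [:: 067012123345] (Branch 146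
  (Bound [:: 027017146345; 057037123146; 025024146136; 056047124123; 046036123125; 023034146156])
  [:: 01235467] (Branch 136 (Bound [:: 027012136345; 045025123136; 047046136123; 057024123136])
  [::] (Branch 124 (Bound [:: 057046124123; 056037123124; 047045125123]) [:: 01235467] (Final
  01234567))))) [:: 01243567; 01253467] (Branch 136 (Force [:: 027012136345] (Branch 146 (Bound
  [:: 025024146136; 057037136146; 047045156136]) [:: 01235467] (Final 01634527))) [:: 01243567;
  01253467] (Final 03451267)))) [::] (Branch 123 (Force [:: 067012123345] (Branch 057 (Branch 146
  (Bound [:: 057037123146; 057047146123; 027026146345; 057023123146; 057025123146; 057035123146;
  057045146123; 057056146123]) [::] (Branch 246 (Bound [:: 057037123246; 057047246123;
  057013123246; 057015123246; 057035123246; 057045246123; 057056246123]) [::] (Branch 124 (Bound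
  [:: 057046124123; 057037123124; 057047124123; 057035123124; 057045124123; 057036123124]) [::]
  (Branch 136 (Bound [:: 027012136345; 057025123136; 057024123136; 057056136123; 057046136123])
  [::] (Bound [:: 046057125123; 027026156345; 047057256123; 057014123236]))))) [:: 01235467]
  (Bound [:: 027012136345; 056037123124; 045015123236; 046036123125; 023024146156;
  013014246256]))) [:: 01243567; 01253467] (Branch 047 (Branch 136 (Bound [:: 027012136345;
  047024236136; 047045156136; 047034136256; 025047146136; 057047246136]) [:: 01254367] (Branch 146
  (Bound [:: 027026146345; 037047146256; 057047146236; 035015146246]) [::] (Branch 013 (Branch 256
  (Force [:: 047013236256; 013047246256] (Final 02653417)) [::] (Branch 015 (Branch 057 (Branch
  014 (Branch 045 (Branch 035 (Branch 037 (Branch 236 (Force [:: 015014246236] (Final 02634517))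
  [::] (Final 02643517)) [::] (Bound [:: 015014246236])) [::] (Bound [:: 015014246236])) [::]
  (Bound [:: 015014246236])) [::] (Bound [:: 015013236246])) [::] (Bound [:: 015013236246])) [::]
  (Bound [:: 057013236246]))) [:: 01254367] (Bound [:: 037047246256])))) [:: 01235467; 01243567]
  (Bound [:: 027012136345; 023024146156; 013014246256])))))))) [:: 10234567] (Branch 167 (Force
  [:: 167012023345; 167012045345; 167012025345; 167012024345; 167012035345; 167012034345] (Branch
  067 (Bound [:: 067012135345; 067012134345; 067012145345; 067012123345; 067012124345;
  067012125345; 017012236345; 127016046345; 027012136345; 013014246256; 037047146156]) [::]
  (Branch 027 (Bound [:: 027167135345; 027012136345; 027012145345; 027167156345; 027167146345;
  027012134345; 017012236345; 127016046345; 037137124246; 056256123147]) [::] (Branch 017 (Force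
  [:: 017012236345; 017012256345; 017012246345] (Branch 123 (Branch 036 (Bound [:: 127017036345;
  047036123125; 046036123157; 056036123147; 057036123124; 037036146145]) [::] (Branch 046 (Bound
  [:: 127016046345; 057046124123; 046056157123; 046037123125; 047046156123]) [:: 01235467] (Branch
  146 (Branch 057 (Force [:: 057037123146; 057047146123] (Final 10753426)) [::] (Branch 156
  (Branch 125 (Branch 145 (Branch 135 (Branch 136 (Branch 124 (Branch 037 (Force [:: 037047145156]
  (Final 10734526)) [::] (Final 10743526)) [::] (Bound [:: 037047145156])) [::] (Bound [::
  037047145156])) [::] (Bound [:: 037047145156])) [::] (Bound [:: 037047146156])) [::] (Bound [::
  037047146156])) [::] (Bound [:: 037047146125]))) [:: 01235467] (Bound [:: 057047134123])))) [::
  01243567; 01253467] (Bound [:: 127016046345; 057047134136; 036037157145]))) [::] (Branch 047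
  (Branch 236 (Bound [:: 047145156236; 047246236135; 127016046345; 047147136236; 047013236256;
  047037236125; 057047124236; 047157123236]) [:: 01254367] (Bound [:: 127016046345; 057047134136;
  037047145156; 056047124123; 135015047246; 036047147125])) [:: 01235467; 01243567] (Branch 147
  (Branch 036 (Bound [:: 036345147127; 147013036256; 147014036236; 036246147157; 036046147125])
  [:: 01254367] (Branch 236 (Bound [:: 147145256236; 127016046345; 157147246236]) [:: 01254367]
  (Bound [:: 127016046345]))) [:: 01235467; 01243567] (Bound [:: 127016046345;
  013014246256]))))))) [:: 10234567] (Branch 127 (Force [:: 127016045345; 127012034345;
  127016046345; 127016035345; 127012056345; 127016036345] (Branch 027 (Bound [:: 027127156345;
  027127135345; 027127134345; 027012136345; 027012145345; 027127146345; 017012236345;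
  137015025246; 147014023256]) [::] (Branch 236 (Force [:: 017012236345] (Branch 047 (Bound [::
  047145156236; 047246236135; 047147136236; 047013236256; 047037236125; 057047124236;
  047157123236]) [:: 01235467] (Bound [:: 145015023236; 157137236246; 025236146147; 014134236256;
  037024124156]))) [:: 01243567; 01253467] (Branch 156 (Branch 146 (Branch 023 (Bound [::
  023024146156; 023025156146; 023047146156; 023057156146; 023037147146]) [::] (Branch 037 (Bound
  [:: 037047146156; 037057156146; 037024146156; 037025156146]) [::] (Branch 057 (Bound [::
  025057137146; 057047146123; 024057156136]) [::] (Branch 024 (Bound [:: 025024146136;
  024047157156]) [::] (Bound [:: 047025156136]))))) [:: 01243567] (Bound [:: 024023135156;
  037047145156; 025057137134])) [:: 01235467; 01245367] (Bound [:: 024023135157;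
  025057137134]))))) [:: 10234567] (Branch 037 (Branch 256 (Force [:: 017012256345] (Branch 147
  (Bound [:: 037147125256; 147037025256; 037147124256; 147037023256; 147037236256; 147037035256;
  037147145256; 037147146256; 147037036256; 147037056256; 037147156256; 037147246256]) [::]
  (Branch 246 (Bound [:: 037034246256; 037047246256; 037057256246; 037135256246; 037014246256;
  037015256246; 037035256246; 037134246256; 037157256246; 037137145246; 037036246125]) [::]
  (Branch 137 (Bound [:: 037137145256; 037137124256; 037137146256; 037137156256; 137037024256;
  137037045256; 137037025256; 137037046256; 037137125256; 137037056256]) [::] (Bound [::
  037047145256; 134037057256; 037036256125; 037034146256; 037024256156; 037013124256;
  014037236256; 045025123136; 046023135157]))))) [:: 01235467] (Branch 156 (Branch 124 (Bound [::
  037057156124; 037047124156; 037023124156; 037024124156; 037034124156; 037036156124;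
  037056156124; 037035156124; 017012236345; 037046124125; 037025124146]) [::] (Branch 146 (Bound
  [:: 037047146156; 037034146156; 037057156146; 037024146156; 037035156146; 037025156146;
  017012236345; 023037147146; 037046146125; 037036146145]) [::] (Branch 047 (Bound [::
  037047145156; 047037135156; 047037136156; 047037236156; 047037123156; 023037147156;
  047036156125; 024047157156; 025046134137]) [::] (Branch 024 (Bound [:: 037024145156;
  024037135156; 024037136156; 024037137156; 024037157156; 037024125156; 017012236345;
  023037147156]) [::] (Bound [:: 017012236345; 023037147156; 037046156125; 034037157156;
  037036156145; 025056136137; 057045134123]))))) [:: 01235467] (Branch 124 (Branch 057 (Bound [::
  057037134124; 057037136124; 057037236124; 037057145124; 057037123124; 037057125124;
  036057147124; 056057137124; 024023135157]) [::] (Branch 056 (Bound [:: 056037123124;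
  037056125124; 056037134124; 056037137124; 056037147124; 037056145124; 017012236345;
  036056157124]) [::] (Branch 145 (Bound [:: 037035145124; 037023124145; 037236124145;
  037046145125; 036037157145; 025047147136; 045024123137]) [::] (Bound [:: 017012236345;
  037046124125; 035037147124; 036037157124; 025024134136; 045047137123])))) [:: 01235467] (Branch
  236 (Bound [:: 017012236345; 145057037236; 147014023236; 045015123236; 047024236135;
  046236137157; 025056136134]) [::] (Branch 137 (Branch 056 (Branch 024 (Bound [:: 056024147137;
  024056157137; 056024134137; 024056135137; 056024123137; 024056136137]) [::] (Bound [::
  025056136137; 056023137147; 046056157137; 056057137134; 056047137123])) [:: 01235467] (Bound [::
  024023137157; 045025123137; 036037147145; 057047134136])) [::] (Branch 145 (Branch 157 (Force
  [:: 023037157145; 036037157145] (Branch 024 (Bound [:: 024046136157; 024034135157;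
  057047134123]) [::] (Bound [:: 046056157123; 025047147136]))) [:: 01235467] (Branch 136 (Bound
  [:: 057047134136; 045025123136; 024046136135]) [::] (Branch 123 (Bound [:: 047024123135;
  056025123134]) [::] (Final 01345267)))) [::] (Branch 157 (Bound [:: 024023135157; 046056157123;
  036035157147; 057047134136]) [:: 01235467] (Bound [:: 057047134136; 046024123135])))))))) [::
  01243567; 01253467; 10234567; 10243567; 10253467] (Branch 013 (Branch 256 (Bound [::
  017012256345; 013014246256; 134013025256; 034013125256; 145015023236; 024046156135;
  035056146124]) [:: 01235467] (Branch 145 (Bound [:: 017012236345; 023025145146; 036046145125;
  045024123136; 056035134124]) [:: 10234567] (Bound [:: 017012236345; 024023135156;
  035025124146]))) [:: 01243567; 01253467] (Bound [:: 017012236345; 024023135156; 045025123136;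
  034036256125]))))))))) [:: 01234576; 02134567; 02134576; 12034567; 12034576; 34501267; 34501276;
  35401267; 35401276; 45301267; 45301276] (Branch 267 (Force [:: 267012013345; 267012014345;
  267012134345; 267012015345; 267012145345; 267012135345; 267012035345; 267012045345;
  012267567345; 012267367345; 267012034345; 012267467345] (Branch 167 (Bound [:: 167012023345;
  167012234345; 167012235345; 167012025345; 167012024345; 167012245345; 067267124345;
  037237125156; 157137236246; 136056057247; 047046256123]) [:: 10234567] (Branch 037 (Branch 156
  (Bound [:: 037234125156; 037047146156; 037237245156; 023037147156; 156136037247; 037057156124;
  037157156246; 037137156256; 046036235257]) [:: 01235467] (Branch 124 (Bound [:: 037137124245;
  056037123124; 037157124246; 057037136124; 037046124125; 037047124256; 036037147124]) [::
  01235467] (Bound [:: 136037057245; 157037236246; 047037235256; 046025257137; 056023234147])))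
  [:: 01234576; 01243567; 01243576; 01253467; 01253476; 10234567; 10234576; 10243567; 10243576;
  10253467; 10253476] (Bound [::])))) [:: 02134567; 12034567; 34501267; 35401267; 45301267]
  (Branch 236 (Branch 147 (Branch 057 (Bound [:: 147057235236; 147057256236; 057147234236;
  057147246236; 057147146236; 057147124236; 147057023236; 147057025236; 057147123236;
  057147134236; 147057035236; 147057036236; 057147136236; 147057056236; 015057237236;
  157147024236; 145057037236]) [::] (Branch 157 (Bound [:: 147157056236; 157147024236;
  157147246236; 147157256236; 157147234236; 157147046236; 147157235236; 147157035236;
  157147034236; 147157025236; 147014023236; 036236125157; 015157237236; 047147156236;
  045147137236; 145147037236]) [:: 54321067] (Branch 015 (Bound [:: 147015235236; 147015023236;
  147015025236; 015147237236; 147015056236; 147015036236; 147015256236; 147015035236;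
  015147246236; 015147247236; 015147234236; 045015123236; 014147257236; 145015037236]) [::
  54321067] (Branch 014 (Bound [:: 147014023236; 147014035236; 147014025236; 014147237236;
  014147257236; 147014056236; 147014036236; 147145256236; 014146236235; 156013234247;
  046246123135; 037137124245]) [:: 54321067] (Branch 056 (Bound [:: 056236137147; 056236247147;
  056236123147; 056236234147; 056236237147; 056236124147; 056236134147; 035056146147;
  036236245147; 147013236256]) [::] (Branch 146 (Bound [:: 025236146147; 147146236235;
  023236146147; 035236146147; 036236245147; 147013236256; 037137146246; 034146125257;
  156146234237]) [::] (Bound [:: 036236245147; 147013236256; 025236136147; 023236156147;
  035236124147; 147046236235; 135037247246; 034134125257]))))))) [:: 01235467; 10234567; 10235467]
  (Branch 015 (Branch 247 (Bound [:: 015014247236; 015145247236; 015135236247; 015013236247;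
  015056236247; 015156236247; 015136236247; 015036236247; 015045247236; 015035236247;
  015046236237; 015137247246; 025235134146]) [::] (Branch 246 (Bound [:: 015014246236;
  015045246236; 015135236246; 015145246236; 015013236246; 015137236246; 015035236246;
  015037236246; 015046236237; 015056246234; 025024146136; 036034245125]) [::] (Branch 014 (Force
  [:: 014015235236; 015014234236; 014015256236; 014015257236] (Branch 237 (Bound [:: 015046236237;
  014156236237; 014146236237; 014056236237; 145015023236; 045014137236; 025024134136]) [::]
  (Branch 145 (Bound [:: 145015023236; 145014036236; 145014037236; 045014137236; 025024146136;
  046034135125]) [:: 10234567] (Branch 245 (Bound [:: 037137124245; 036034245125; 025245146136;
  024023135156]) [::] (Bound [:: 024023135156; 025056136137; 037046146125]))))) [::] (Branch 237
  (Force [:: 015046236237; 015056236237; 015156236237; 015146236237] (Branch 136 (Force [::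
  045015136236] (Branch 145 (Bound [:: 145015023236; 015145234236; 145015036236; 145015037236;
  025024134136]) [::] (Branch 257 (Bound [:: 136034024257; 136037257245; 136013025257;
  134136256257]) [::] (Bound [:: 025024134136; 013136256245; 036035125124])))) [:: 10234567]
  (Bound [:: 145015023236; 045015123236; 137013024256; 134034025257]))) [::] (Branch 234 (Force
  [:: 015145234236; 015056236234; 015156236234; 015045234236] (Branch 146 (Bound [:: 146013235257;
  025024146136; 037137146245; 035023124146; 034036256125]) [:: 10234567] (Branch 245 (Bound [::
  037137124245; 013134245256; 036034245125]) [::] (Bound [:: 137013024256; 136036025257])))) [::]
  (Branch 136 (Force [:: 045015136236] (Branch 257 (Bound [:: 145015023236; 136034024257;
  046136123257; 146136037257; 136013025257; 136134245257; 036136124257]) [::] (Branch 245 (Bound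
  [:: 145015023236; 137136056245; 037136146245; 136013025245; 136036024245; 046034135125]) [::]
  (Bound [:: 145015023236; 025024146136; 046256135137; 056037123124; 034036156125])))) [::
  10234567] (Bound [:: 145015023236; 045015123236; 146013235257; 046256135137; 034024125156;
  056035134124]))))))) [:: 01235467; 45320167; 45321067] (Branch 156 (Branch 247 (Bound [::
  156013234247; 037247125156; 156046247237; 156035023247; 024247137156; 136156025247;
  156036034247; 056156134247; 135156246247]) [:: 45320167] (Branch 024 (Bound [:: 024023135156;
  034024125156; 024237137156; 156056024234; 024025156136; 146013235257; 036035245124]) [::
  45320167] (Bound [:: 156046234237; 023025156146; 137136056245; 013134246256; 036035125124])))
  [:: 01235467; 10234567; 10235467] (Branch 013 (Branch 247 (Bound [:: 136013025247; 013134247256;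
  013135245247; 036013125247; 035013124247]) [:: 01235467] (Bound [:: 137013024256; 013135245246;
  036035125124])) [:: 45320167] (Bound [:: 135037247246; 025024134136; 034036256125]))))) [::
  01234576; 01243567; 01243576; 01253467; 01253476; 02134567; 02134576; 02143567; 02143576;
  02153467; 02153476; 12034567; 12034576; 12043567; 12043576; 12053467; 12053476] (Bound [::]))).
Definition cert_intersecting8 : cert :=
  Branch 045 (Force [:: 045123; 045126; 045127; 045136; 045137; 045167; 045236; 045237; 045267;
  045367] (Branch 124 (Bound [:: 035124; 036124; 037124; 056124; 057124; 067124; 124356; 124357;
  124567; 034125; 025134; 024135; 023145; 027146; 026147; 047156; 046157; 015234; 014235; 013245;
  017246; 016247; 012345; 257346; 256347]) [:: 01235467; 01324567; 01325467; 01624537; 01625437;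
  01724536; 01725436; 02314567; 02315467; 02614537; 02615437; 02714536; 02715436; 03614527;
  03615427; 03714526; 03715426; 06714523; 06715423; 41230567; 41320567; 41620537; 41720536;
  42310567; 42610537; 42710536; 43610527; 43710526; 46710523] (Bound [::]))) [:: 01234657;
  01234756; 01235647; 01235746; 01236745; 01243567; 01243657; 01243756; 01253467; 01342567;
  01342657; 01342756; 01352467; 01452367; 02341567; 02341657; 02341756; 02351467; 02451367;
  03451267; 10234567; 10234657; 10234756; 10235647; 10235746; 10236745; 10243567; 10243657;
  10243756; 10253467; 10342567; 10342657; 10342756; 10352467; 10452367; 20134567; 20134657;
  20134756; 20135647; 20135746; 20136745; 20143567; 20143657; 20143756; 20153467; 30124567;
  30124657; 30124756; 30125647; 30125746; 30126745; 40125637; 40125736; 40126735; 50126734] (Bound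
  [::]).
Definition cert_paths9 : cert :=
  Branch 267 (Force [:: 267012013345; 267012014345; 267012058345; 267012015345; 267012134345;
  267012135345; 267012138345; 012267356345; 267012145345; 267012148345; 267012158345;
  267012034345; 267012048345; 012267467345; 012267578345; 012267456345; 012267367345;
  012267468345; 267012038345; 012267357345; 012267568345; 012267478345; 012267368345;
  012267346345; 267012045345; 012267347345; 012267457345; 267012035345; 012267567345;
  012267378345] (Branch 348 (Bound [:: 267012018348; 012268348345; 012025345348; 012156345348;
  012157345348; 012168348345; 012178348345; 012278348345; 012028348345; 012125345348;
  012256345348; 012257345348; 012068348345; 012056345348; 012078348345; 267678348345;
  012057345348; 012128348345; 016012234345; 017012235345; 067012123345; 167012023345;
  027012136348; 012024345358; 026012137348; 127267046348]) [:: 012354678; 012453678] (Branch 078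
  (Bound [:: 078012123345; 078267156345; 078267234345; 078267235345; 078267236345; 078267146345;
  078267125345; 078012245345; 078012246345; 078012136345; 078012256345; 078012124345;
  268012137345; 167012023345; 017012238345; 168012247345; 018012237345; 016012248345;
  026078157345; 178012024345; 278012046345; 126012047345; 068012147345]) [:: 012345768; 102345678;
  102345768] (Branch 018 (Bound [:: 018012234345; 018012235345; 018012236345; 018012237345;
  018012245345; 018012246345; 018012247345; 018012256345; 018012257345; 067012123345;
  268012137345; 167012023345; 017012238345; 016012248345; 278012136345; 028018156345;
  027012146345; 026012147345; 126012047345]) [::] (Branch 678 (Bound [:: 345023267678;
  345024267678; 345124267678; 345025267678; 345245267678; 345234267678; 345125267678;
  345235267678; 345123267678; 268012137345; 017012236345; 167012248345; 016012237345;
  278012136345; 027012146345; 067678238345; 028012156345; 026012147345]) [::] (Branch 016 (Bound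
  [:: 016012234345; 016012235345; 016012237345; 016012238345; 016012245345; 016012247345;
  016012248345; 016012257345; 016012258345; 067012123345; 268012137345; 167012023345;
  017012236345; 026016147345; 278012136345; 028016146345; 126012047345]) [:: 012345768] (Branch
  137 (Bound [:: 268012137345; 026012137345; 028012137345; 067012123345; 167012234345;
  278012136345; 027012146345; 046345137127; 126012047345; 128012037345; 036137247258;
  157137023248; 056024237137; 057137238246; 025235137147]) [:: 012345768; 012435678; 012435768;
  012534678; 012534768; 102345678; 102345768; 102435678; 102435768; 102534678; 102534768] (Branch
  067 (Bound [:: 067012123345; 067012124345; 067012125345]) [:: 102345678] (Final
  234501678))))))))) [:: 012345687; 012345786; 021345678; 021345687; 021345786; 120345678;
  120345687; 120345786; 345012678; 345012687; 345012786; 354012678; 354012687; 354012786;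
  453012678; 453012687; 453012786] (Branch 678 (Branch 016 (Bound [:: 016012234345; 016012235345;
  016012237345; 016012238345; 016012245345; 016012247345; 016012248345; 016012257345;
  016012258345; 012016356345; 012016456345; 345015016678; 012016346345; 345013016678;
  345014016678; 012016678347; 012016678348; 345023016678; 012016678357; 345024016678;
  012016678358; 345025016678; 345124016678; 345125016678; 345134016678; 345135016678;
  345145016678; 345034016678; 012016678457; 345035016678; 012016678458; 345123016678;
  345045016678; 018012236345; 026016147345; 028016146345; 017016246345; 027012136345]) [::
  012345768; 012345867; 021345678; 021345768; 021345867; 120345678; 120345768; 120345867;
  345012678; 345012768; 345012867; 354012678; 354012768; 354012867; 453012678; 453012768;
  453012867] (Branch 234 (Bound [:: 234012056678; 234012157678; 234012158678; 234345058678;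
  234012057678; 234012156678; 135234046678; 145345037678; 024234137678; 025234147678;
  125234036678; 134234258678; 035234146678; 014345257678; 123234047678; 045234238678;
  235234148678; 015345246678; 013234247678; 124345038678]) [:: 012354678; 012453678; 021345678;
  021354678; 021453678; 120345678; 120354678; 120453678; 345012678; 345021678; 345120678;
  354012678; 354021678; 354120678; 453012678; 453021678; 453120678] (Bound [:: 147148238236;
  056058248247]))) [::] (Branch 016 (Force [:: 016012234345; 016012235345; 016012237345;
  016012238345; 016012245345; 016012247345; 016012248345; 016012257345; 016012258345;
  012016356345; 012016456345; 012016346345] (Branch 357 (Force [:: 016017357345; 012014345357;
  016027357345; 012024345357; 012046345357; 012146345357; 012148345357; 012246345357;
  012124345357; 012048345357; 012127357345] (Branch 348 (Bound [:: 016015345348; 016025345348;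
  012018348357; 016028348357; 012156345348; 012157345348; 012125345348; 012256345348;
  012056345348; 012057345348; 012128348345; 026016147345; 012158357347; 126016034348]) [::
  012543678] (Bound [:: 018012236345; 016015357347; 026016147345; 028012157357; 126016034357;
  016023345457; 128016035357; 012047345358; 134037056256; 057025123136; 038036156145;
  045058138137]))) [:: 012345687; 012354678; 012354687; 012435678; 012435687] (Branch 026 (Force
  [:: 026016147345; 026016148345; 026012158345; 026012134345; 026016135345; 026016137345;
  026016138345; 026012145345; 026012157345] (Branch 018 (Bound [:: 018012236345; 018012246345;
  018012256345; 028016146345; 027012136345; 126012058345; 128026056345; 127026034345;
  047036123125; 038057156124]) [:: 012345687] (Bound [:: 028016146345; 027012136345; 126012058345;
  128026056345; 127026034345; 014013236256; 047036123125; 037057156246]))) [:: 102345678] (Branch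
  027 (Bound [:: 027012134345; 027012135345; 027012136345; 027012138345; 027012145345;
  027012146345; 027012148345; 027012156345; 027012158345; 018012236345; 017016246345;
  127012058345; 028012157345; 128027046345; 147013023256; 047036123125; 056035137124]) [::
  012345687; 102345678; 102345687] (Branch 023 (Branch 147 (Bound [:: 018012236345; 147013023256;
  023037147145; 017016246345; 023034147157; 023057147148; 023038158147; 056023138147;
  023048147156; 025023137147; 058023124147; 023036146147; 045024123136]) [:: 012345687; 012354678;
  012354687] (Branch 246 (Bound [:: 018012246345; 017016246345; 037023246156; 035023246146;
  038023246145; 137015024246; 046246123138; 057013136246; 048246125135]) [:: 012354678] (Branch
  156 (Bound [:: 018012236345; 024023135156; 023025156146; 034023125156; 047023123156;
  048023137156; 038023124156]) [:: 012354678] (Bound [:: 018012236345; 037023125145; 025047134138;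
  057024123136; 048045135137])))) [:: 012435678; 012534678; 102345678; 102435678; 102534678]
  (Bound [:: 018012236345; 017016246345; 035036146147; 134048056256; 046034137157; 047037136158;
  057045148138])))))) [:: 012345768; 012345867; 021345678; 021345768; 021345867; 120345678;
  120345768; 120345867; 345012678; 345012768; 345012867; 354012678; 354012768; 354012867;
  453012678; 453012768; 453012867] (Branch 147 (Branch 023 (Branch 158 (Bound [:: 023034147158;
  023038158147; 023056158147; 023238158147; 023047147158; 023024147158; 023246147158;
  023234147158; 023235158147; 023046147158; 023247147158; 023256158147; 023258158147;
  023035158147; 023058158147; 023025158147; 023237147158; 023037147158; 147015023236]) [::
  012345876] (Bound [:: 147013023256; 023037147145; 147047023238; 023034147157; 147015023236;
  023057147148; 147134023258; 038023247147; 147046023235; 056023138147; 025023137147;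
  058023124147; 036023248147; 035023246147; 023237147146; 045024123136; 048014125257])) [::
  012543678; 345012678; 345210678] (Branch 236 (Bound [:: 147148238236; 048147137236;
  147037236256; 038236124147; 045147136236; 057147138236; 158147246236; 147013236258;
  014147257236; 145147237236; 036236125147; 056236123147; 157147034236; 015147247236;
  047147135236]) [:: 012345876; 012543678; 012543876; 210345678; 210345876; 210543678; 210543876]
  (Bound [:: 137015024246; 156013234247; 158148034237; 136146047257; 046245123138; 048248125135;
  057037134124]))) [:: 012345687; 012345768; 012354678; 012354687; 012354768; 012435678;
  012435687; 012435768; 021345678; 021345687; 021345768; 021354678; 021354687; 021354768;
  021435678; 021435687; 021435768; 102345678; 102345687; 102345768; 102354678; 102354687;
  102354768; 102435678; 102435687; 102435768] (Bound [::])))).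
Definition cert_intersecting9 : cert :=
  Branch 045 (Force [:: 045123; 045126; 045127; 045128; 045136; 045137; 045138; 045167; 045168;
  045178; 045236; 045237; 045238; 045267; 045268; 045278; 045367; 045368; 045378; 045678] (Branch
  124 (Force [:: 035124; 036124; 037124; 038124; 056124; 057124; 058124; 067124; 068124; 078124;
  124356; 124357; 124358; 124567; 124568; 124578] (Branch 026 (Bound [:: 026134; 026135; 026145;
  026147; 026148; 026157; 026158; 026345; 026347; 026348; 026457; 026458; 026478; 034125; 023146;
  024156; 015234; 014235; 013245; 017246]) [:: 012345768; 012345867; 012645378; 021345678;
  021345768; 021345867; 021645378; 512340678; 512340768; 512340867; 512640378; 521340678;
  521340768; 521340867; 521640378] (Bound [:: 034125; 025134; 015234; 012345]))) [:: 012354678;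
  013245678; 013254678; 016245378; 016254378; 017245368; 017254368; 018245367; 018254367;
  023145678; 023154678; 026145378; 026154378; 027145368; 027154368; 028145367; 028154367;
  036145278; 036154278; 037145268; 037154268; 038145267; 038154267; 067145238; 067154238;
  068145237; 068154237; 078145236; 078154236; 412305678; 413205678; 416205378; 417205368;
  418205367; 423105678; 426105378; 427105368; 428105367; 436105278; 437105268; 438105267;
  467105238; 468105237; 478105236] (Bound [::]))) [:: 012346578; 012347568; 012348567; 012356478;
  012357468; 012358467; 012367458; 012368457; 012378456; 012435678; 012436578; 012437568;
  012438567; 012534678; 013425678; 013426578; 013427568; 013428567; 013524678; 014523678;
  023415678; 023416578; 023417568; 023418567; 023514678; 024513678; 034512678; 102345678;
  102346578; 102347568; 102348567; 102356478; 102357468; 102358467; 102367458; 102368457;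
  102378456; 102435678; 102436578; 102437568; 102438567; 102534678; 103425678; 103426578;
  103427568; 103428567; 103524678; 104523678; 201345678; 201346578; 201347568; 201348567;
  201356478; 201357468; 201358467; 201367458; 201368457; 201378456; 201435678; 201436578;
  201437568; 201438567; 201534678; 301245678; 301246578; 301247568; 301248567; 301256478;
  301257468; 301258467; 301267458; 301268457; 301278456; 401256378; 401257368; 401258367;
  401267358; 401268357; 401278356; 501267348; 501268347; 501278346; 601278345] (Bound [::]).
Definition cert_paths10 : cert :=
  Branch 279 (Force [:: 279012013345; 012279569345; 012279479345; 279012036345; 012279478345;
  279012146345; 279012136345; 012279349345; 012279389345; 279012014345; 279012015345;
  012279579345; 279012046345; 012279359345; 012279357345; 279012034345; 012279378345;
  012279589345; 012279457345; 279012134345; 012279467345; 279012158345; 279012056345;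
  012279367345; 279012148345; 012279469345; 279012058345; 012279459345; 279012156345;
  012279379345; 279012138345; 012279578345; 279012035345; 012279567345; 012279369345;
  279012038345; 279012045345; 279012048345; 012279489345; 279012145345; 279012135345;
  012279347345] (Branch 568 (Bound [:: 012024345568; 012167568345; 279789568345; 012067568345;
  012068568345; 012026568345; 279147345568; 012037345568; 279267568345; 012249345568;
  279269568345; 279089568345; 279012016568; 279239345568; 279237345568; 279137345568;
  012189568345; 012128568345; 279679568345; 012018568345; 012278568345; 012247345568;
  279023345568; 279028568345; 279234345568; 279069568345; 279268568345; 012279689568;
  012169568345; 012178568345; 279047345568; 012123345568; 279126568345; 012149345568;
  012124345568; 012039345568; 279012168568; 279139345568; 279049345568; 012289568345;
  279678568345; 279078568345]) [:: 0123546789; 0124536789] (Branch 168 (Bound [:: 168012023345;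
  012168456345; 279012168346; 168012237345; 012168348345; 168012247345; 168012234345;
  168012259345; 012168356345; 168012057345; 168012039345; 168012235345; 168012049345;
  012168458345; 168012239345; 168012245345; 168012024345; 279012168358; 168012047345;
  168012257345; 168012059345; 168012025345; 168012249345; 168012037345; 017012246345;
  278279149345; 078279124345; 178168256345; 069279258345; 268168137345; 068012157345;
  267279139345; 027279169168; 067012123345; 269012147345; 089012125345; 168016029279;
  079279238345; 345248168679]) [:: 1023456789] (Branch 678 (Bound [:: 012279678458; 012279678356;
  345039279678; 345235279678; 012279678346; 345159279678; 345239279678; 345023279678;
  345049279678; 279678456345; 345025279678; 279678358345; 345024279678; 345249279678;
  345139279678; 345234279678; 345245279678; 345125279678; 345149279678; 279678348345;
  345124279678; 345259279678; 345123279678; 345059279678; 019012237345; 017012246345;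
  018012247345; 069279258345; 189012037345; 268678137345; 269678157345; 129012078678;
  169678257345; 128012047345; 067279238345; 012027678689; 012248678679]) [:: 0123456987] (Branch
  456 (Bound [:: 012069456345; 279167456345; 012279679456; 279037345456; 012169456345;
  279067456345; 012039345456; 012016456345; 279126456345; 012026456345; 279268456345;
  012137345456; 279237345456; 279267456345; 279239345456; 279123345456; 279139345456;
  012238345456; 012023345456; 279269456345; 017012235345; 179012234456; 189012024345;
  018012245345; 019012247345; 178012236456; 078012125456; 279159456346; 278279149345;
  279128458345; 279157456348; 079279258456; 089012124345; 279289358345; 127012059456]) [::
  0123458769; 0124356789; 0124358769; 0125346789; 0125348769] (Branch 016 (Bound [:: 016012239345;
  016012237345; 016012238345; 016012245345; 016012247345; 016012234345; 016012248345;
  016012249345; 016012235345; 016012257345; 016012258345; 016012259345; 016012279789;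
  167012023345; 189012024345; 017012246345; 278279149345; 078279124345; 267279139345;
  126279037345; 268012039345; 129016057345; 089016137345; 269279157345; 067012123345;
  128012047345; 018016236279; 169279025345; 079279256345]) [:: 0123458769] (Branch 167 (Bound [::
  167012023345; 167279239345; 167279249345; 167012238345; 167012234345; 167012039345;
  167012025345; 167012259345; 167012235345; 167012049345; 167012258345; 167279248345;
  167279024345; 167012245345; 167012059345; 019012237345; 017012246345; 027167139345;
  278279149345; 078279124345; 178167256345; 189012037345; 268167137345; 128167047345;
  169279247345; 269279157345; 067167123345]) [:: 0123456987; 0123458769; 0123458967; 1023456789;
  1023456987; 1023458769; 1023458967] (Branch 789 (Bound [:: 345124279789; 345023279789;
  345234279789; 345125279789; 345123279789; 345025279789; 345256279789; 345246279789;
  345236279789; 345245279789; 345235279789; 345024279789; 019012237345; 017012239345;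
  278279149345; 267279139345; 126279037345; 128789047345; 268012039345]) [:: 0123458769] (Branch
  149 (Bound [:: 278279149345; 027279149345; 026012149345; 268012149345; 267012149345;
  028279149345; 017012235345; 019012237345; 179149345256; 126279037345; 079279258345;
  269279157345; 128012047345; 127012039345; 289279057345; 029012147345; 149059023238]) [::
  0123456987; 0123546789; 0123546987; 0124356789; 0124356987; 1023456789; 1023456987; 1023546789;
  1023546987; 1024356789; 1024356987] (Branch 017 (Bound [:: 017012235345; 017012239345;
  017012245345; 017012246345; 017012258345]) [:: 0123456987] (Branch 079 (Bound [:: 079279258345;
  079279256345; 079279234345]) [:: 1023456789] (Final 2345016789)))))))))))) [:: 0123456798;
  0123456879; 0123457689; 0123457698; 0123458697; 0213456789; 0213456798; 0213456879; 0213457689;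
  0213457698; 0213458697; 1203456789; 1203456798; 1203456879; 1203457689; 1203457698; 1203458697;
  3450126789; 3450126798; 3450126879; 3450127689; 3450127698; 3450128697; 3540126789; 3540126798;
  3540126879; 3540127689; 3540127698; 3540128697; 4530126789; 4530126798; 4530126879; 4530127689;
  4530127698; 4530128697] (Branch 689 (Branch 679 (Bound [:: 345137679689; 345258689679;
  012158689679; 012147679689; 012037679689; 012148689679; 012028689679; 012257679689;
  345458689679; 012247679689; 345238689679; 345237679689; 012017679689; 345047679689;
  345048689679; 012057679689; 012138689679; 012018689679; 345358689679; 012157679689;
  012027679689; 012248689679; 345457679689; 012058689679; 012038689679; 012128689679;
  345357679689; 345347679689; 345348689679; 012127679689; 234012016689; 235012149679;
  024012159679; 245012019679; 014012236679; 015012239679; 012025459679; 013012246679;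
  345035029679; 124345359679; 012129349345; 134345059679; 045012139679; 012259679346;
  123345456679; 125012049679; 345056679789; 345023026689]) [:: 0123456798; 0123458769] (Branch 016
  (Bound [:: 234012016689; 237012016689; 235012016689; 016012239345; 245012016689; 247012016689;
  016689459345; 012016689458; 016689358345; 345024016689; 016689238345; 016689258345;
  345035016689; 012016356345; 345135016689; 012016456345; 345013016689; 345014016689;
  345015016689; 016012248345; 345023016689; 016012249345; 345025016689; 345034016689;
  012016689348; 345137016689; 016012257345; 345037016689; 345047016689; 345134016689;
  345123016689; 345145016689; 345147016689; 016689349345; 016012259345; 345124016689;
  345125016689; 345057016689; 012016689359; 012016346345; 345157016689; 345045016689;
  017012246689; 012048345357; 347027016689]) [:: 0123458769; 0123459768; 0213456789; 0213458769;
  0213459768; 1203456789; 1203458769; 1203459768; 3450126789; 3450128769; 3450129768; 3540126789;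
  3540128769; 3540129768; 4530126789; 4530128769; 4530129768] (Bound [:: 017012235345;
  237012156689; 014012238689; 015012239689; 013012246689; 012048345357; 134345059689;
  037345259689; 247345058689; 127012038689; 045012139689; 025012136689; 047345258689;
  137012248689; 147012236689; 257012049689; 234012158689; 012138345457; 057012146689;
  027012159689; 125012036689; 124012056689; 157345249689; 145345039689; 135012046689;
  035345148689; 034345256689]))) [:: 0123456879; 0123456978; 0123457689] (Branch 017 (Force [::
  017012235345; 017012239345; 017012245345; 017012246345; 017012258345; 017012234345;
  017012248345; 017012249345; 017012256345; 017012238345; 012017347345; 017012236345;
  017012259345; 012017357345; 012017457345] (Branch 127 (Bound [:: 127012046345; 127012039345;
  127012058345; 127012056345; 127017048345; 127012038345; 127012049345; 127012059345;
  127012036345; 127017034345; 127012045345; 127012035345; 019012237345; 018012247345;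
  017037345456; 012129349345; 127139345458; 017128348345; 012146345358; 127149345356;
  026012157345; 127148345359; 126012047345; 127138345459; 028127134345; 017257345346;
  027127145345; 029017158345; 024023135159]) [:: 1023456789] (Branch 129 (Bound [:: 129012058345;
  012129349345; 129017057345; 129017037345; 129012046345; 129012056345; 129012048345;
  129017034345; 012129459345; 129017035345; 129017047345; 129017038345; 129012045345;
  012129359345; 129012036345; 019012237345; 018012247345; 129126346345; 017049345356;
  028129139345; 017128348345; 012146345358; 026012149345; 029129157345; 012123345458;
  012039345456; 016012257345]) [:: 0123456798; 0123458796; 1023456789; 1023456798; 1023458796]
  (Branch 356 (Bound [:: 017048345356; 017049345356; 012147345356; 012047345356; 012149345356;
  012016356345; 017014345356; 017024345356; 017148345356; 017247345356; 017124345356;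
  019012237345; 017158356346; 012136356459; 017037345456; 012125356349; 018017257345;
  012036356458; 012056356348; 012146345358; 012046345359]) [:: 0123458769; 0123459768; 0123546789;
  0123548769; 0123549768; 0124356789; 0124358769; 0124359768] (Branch 138 (Bound [:: 019012237345;
  018012247345; 016138345257; 047048138123; 046037138158; 049056125138; 059035138124;
  025038138146; 045058138139; 024023138157; 057036138148; 039034145156]) [:: 0123456798;
  0123458769; 0124356789; 0124356798; 0124358769; 0125346789; 0125346798; 0125348769; 1023456789;
  1023456798; 1023458769; 1024356789; 1024356798; 1024358769; 1025346789; 1025346798; 1025348769]
  (Bound [::])))))) [:: 0123456879; 0123456978; 0123457689; 0213456789; 0213456879; 0213456978;
  0213457689; 1203456789; 1203456879; 1203456978; 1203457689; 3450126789; 3450126879; 3450126978;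
  3450127689; 3540126789; 3540126879; 3540126978; 3540127689; 4530126789; 4530126879; 4530126978;
  4530127689] (Branch 237 (Branch 146 (Bound [:: 146015235237; 146014023237; 046146125237;
  057237236146; 158146249237; 146157237239; 156146234237; 146048258237; 146047237259;
  035237247146; 037237246146; 146036237257; 049146123237; 039237147146; 038237256146;
  025237136146; 056146134237; 045146137237; 159146034237; 146148238237]) [:: 0123458769;
  0123459768; 0123546789; 0123548769; 0123549768; 1023456789; 1023458769; 1023459768; 1023546789;
  1023548769; 1023549768] (Bound [:: 015014234237; 045245237136; 039237257145; 057137236249;
  157013023246; 038139259247; 047024125138; 134034025256])) [:: 0123456879; 0123456978;
  0123457689; 0124356789; 0124356879; 0124356978; 0124357689; 0125346789; 0125346879; 0125346978;
  0125347689; 0213456789; 0213456879; 0213456978; 0213457689; 0214356789; 0214356879; 0214356978;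
  0214357689; 0215346789; 0215346879; 0215346978; 0215347689; 1203456789; 1203456879; 1203456978;
  1203457689; 1204356789; 1204356879; 1204356978; 1204357689; 1205346789; 1205346879; 1205346978;
  1205347689] (Bound [::])))).
Definition cert_intersecting10 : cert :=
  Branch 045 (Force [:: 045123; 045126; 045127; 045128; 045129; 045136; 045137; 045138; 045139;
  045167; 045168; 045169; 045178; 045179; 045189; 045236; 045237; 045238; 045239; 045267; 045268;
  045269; 045278; 045279; 045289; 045367; 045368; 045369; 045378; 045379; 045389; 045678; 045679;
  045689; 045789] (Branch 124 (Bound [:: 035124; 036124; 037124; 038124; 039124; 056124; 057124;
  058124; 059124; 067124; 068124; 069124; 078124; 079124; 089124; 124356; 124357; 124358; 124359;
  124567; 124568; 124569; 124578; 124579; 124589; 034125; 025134; 024135; 023145; 027146; 026147;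
  029148; 028149; 047156; 046157; 049158; 048159; 015234; 014235; 013245; 017246; 016247; 019248;
  018249; 012345; 257346; 256347; 259348; 258349]) [:: 0123546789; 0132456789; 0132546789;
  0162453789; 0162543789; 0172453689; 0172543689; 0182453679; 0182543679; 0192453678; 0192543678;
  0231456789; 0231546789; 0261453789; 0261543789; 0271453689; 0271543689; 0281453679; 0281543679;
  0291453678; 0291543678; 0361452789; 0361542789; 0371452689; 0371542689; 0381452679; 0381542679;
  0391452678; 0391542678; 0671452389; 0671542389; 0681452379; 0681542379; 0691452378; 0691542378;
  0781452369; 0781542369; 0791452368; 0791542368; 0891452367; 0891542367; 4123056789; 4132056789;
  4162053789; 4172053689; 4182053679; 4192053678; 4231056789; 4261053789; 4271053689; 4281053679;
  4291053678; 4361052789; 4371052689; 4381052679; 4391052678; 4671052389; 4681052379; 4691052378;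
  4781052369; 4791052368; 4891052367] (Bound [::]))) [:: 0123465789; 0123475689; 0123485679;
  0123495678; 0123564789; 0123574689; 0123584679; 0123594678; 0123674589; 0123684579; 0123694578;
  0123784569; 0123794568; 0123894567; 0124356789; 0124365789; 0124375689; 0124385679; 0124395678;
  0125346789; 0134256789; 0134265789; 0134275689; 0134285679; 0134295678; 0135246789; 0145236789;
  0234156789; 0234165789; 0234175689; 0234185679; 0234195678; 0235146789; 0245136789; 0345126789;
  1023456789; 1023465789; 1023475689; 1023485679; 1023495678; 1023564789; 1023574689; 1023584679;
  1023594678; 1023674589; 1023684579; 1023694578; 1023784569; 1023794568; 1023894567; 1024356789;
  1024365789; 1024375689; 1024385679; 1024395678; 1025346789; 1034256789; 1034265789; 1034275689;
  1034285679; 1034295678; 1035246789; 1045236789; 2013456789; 2013465789; 2013475689; 2013485679;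
  2013495678; 2013564789; 2013574689; 2013584679; 2013594678; 2013674589; 2013684579; 2013694578;
  2013784569; 2013794568; 2013894567; 2014356789; 2014365789; 2014375689; 2014385679; 2014395678;
  2015346789; 3012456789; 3012465789; 3012475689; 3012485679; 3012495678; 3012564789; 3012574689;
  3012584679; 3012594678; 3012674589; 3012684579; 3012694578; 3012784569; 3012794568; 3012894567;
  4012563789; 4012573689; 4012583679; 4012593678; 4012673589; 4012683579; 4012693578; 4012783569;
  4012793568; 4012893567; 5012673489; 5012683479; 5012693478; 5012783469; 5012793468; 5012893467;
  6012783459; 6012793458; 6012893457; 7012893456] (Bound [::]).

End Certificates.

(** * Verification of the search trees and what they prove *)

Definition base_pair : seq (seq nat) := [:: [:: 0; 1; 2]; [:: 3; 4; 5]].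

(** The thresholds 20, 22, 29, 37 of this check and the next three are the claimed extremal numbers.
    The intersecting searches have no target because, by the Erdos-Ko-Rado theorem, intersecting
    families have at most C(n-1,2) triples, that is 15, 21, 28, 36. *)
Lemma check7 : check 7 20 (path_obs 7) [:: clique_plus_point] base_pair (all_triples 7) cert_paths7
  && check 7 20 (disjoint_obs 7) [::] [::] (all_triples 7) cert_intersecting7.
Proof. by vm_compute. Qed.

Lemma check8 : check 8 22 (path_obs 8) [:: starplus_triples 8; SP_triples; SK_triples]
   base_pair (all_triples 8) cert_paths8
  && check 8 22 (disjoint_obs 8) [::] [::] (all_triples 8) cert_intersecting8.
Proof. by vm_compute. Qed.

Lemma check9 : check 9 29 (path_obs 9) [:: starplus_triples 9] base_pair (all_triples 9) cert_paths9
  && check 9 29 (disjoint_obs 9) [::] [::] (all_triples 9) cert_intersecting9.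
Proof. by vm_compute. Qed.

Lemma check10 : check 10 37 (path_obs 10) [:: starplus_triples 10] base_pair (all_triples 10) cert_paths10
  && check 10 37 (disjoint_obs 10) [::] [::] (all_triples 10) cert_intersecting10.
Proof. by vm_compute. Qed.

Definition triples_in (V : finType) (W : {set V}) : {set {set V}} :=
  [set e : {set V} | (#|e| == 3) && (e \subset W)].

Lemma triples_inP (V : finType) (W : {set V}) (E : {set {set V}}) (e : {set V}) :
  E \subset triples_in W -> e \in E -> #|e| = 3 /\ e \subset W.
Proof. by move=> /subsetP s /s; rewrite inE => /andP[/eqP]. Qed.

Section Obstructions.
Variables (n : nat) (V : finType) (x0 : V) (W : {set V}) (s : seq V).
Hypothesis lab : labelling n W s.

Lemma meets_place c d : wf n c -> wf n d ->
  meets (place x0 s c) (place x0 s d) = share c d.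
Proof.
have [us sn _] := lab.
move=> /allP wc /allP wd; apply/meetsP/hasP => [[x /placeP[i ic ->] /placeP[j jd]]|[i id ic]].
  move=> /eqP; rewrite nth_uniq ?sn ?(wc i) ?(wd j) // => /eqP ij; subst j.
  by exists i.
by exists (nth x0 s i); apply/placeP; exists i.
Qed.

Lemma path_obsP (E : {set {set V}}) p : P4free E -> path_obs n p ->
  exists2 c, c \in p & place x0 s c \notin E.
Proof.
move=> F; case: p => [|a [|b [|c [|d [|e p]]]]] //= /andP[/and5P[wa wb wc wd _] pth].
apply/hasP/negPn; rewrite -all_predC; apply/negP => /and5P[/= /negPn aE /negPn bE /negPn cE /negPn dE _].
by have := F _ _ _ _ aE bE cE dE; rewrite /path4 !meets_place // pth.
Qed.

Lemma disjoint_obsP (E : {set {set V}}) p : {in E &, forall d e, meets d e} -> disjoint_obs n p ->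
  exists2 c, c \in p & place x0 s c \notin E.
Proof.
move=> I; case: p => [|a [|b [|c p]]] //= /andP[/and3P[wa wb _] dis].
apply/hasP/negPn; rewrite -all_predC; apply/negP => /and3P[/= /negPn aE /negPn bE _].
by have := I _ _ aE bE; rewrite meets_place // (negbTE dis).
Qed.
End Obstructions.

Lemma labelling_enum (V : finType) (W : {set V}) : labelling #|W| W (enum W).
Proof. by split; [apply: enum_uniq | rewrite -cardE | move=> x; rewrite mem_enum]. Qed.

Lemma wf_all_triples n : all (wf n) (all_triples n).
Proof.
apply/allP => c; rewrite mem_filter => /andP[_ /allpairsP[[[i j] k] [/= ij kn ->]]].
move: kn; have /allpairsP[[i' j'] [/= + + [-> ->]]] := ij.
by rewrite !mem_iota /= => -> -> ->.
Qed.

(** An intersecting [E] is refuted by [certI], whose target list is empty. Otherwise two disjoint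
    edges can receive the labels of [base_pair], the starting point of [certP]. *)
Lemma certificate_sound n K targets certP certI :
  0 < K -> 6 <= n ->
  check n K (path_obs n) targets base_pair (all_triples n) certP
    && check n K (disjoint_obs n) [::] [::] (all_triples n) certI ->
  forall (V : finType) (W : {set V}) (E : {set {set V}}),
    #|W| = n -> E \subset triples_in W -> P4free E -> K <= #|E| ->
  exists x0 s t, [/\ labelling n W s, t \in targets & models x0 E s t].
Proof.
move=> K0 n6 /andP[chP chI] V W E Wn EW F KE.
have /card_gt0P[e0 e0E] : 0 < #|E| by lia.
have [e03 _] := triples_inP EW e0E.
have /card_gt0P[x0 _] : 0 < #|e0| by rewrite e03.
have sE s : labelling n W s -> forall e, e \in E -> e \in map (place x0 s) (all_triples n).
  by move=> lab e eE; have [e3 eW] := triples_inP EW eE; apply: all_triplesP lab eW e3.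
case: (boolP [forall d in E, forall e in E, meets d e]) => [/forall_inP I|].
  have lab := labelling_enum W; rewrite Wn in lab.
  have I' : {in E &, forall d e, meets d e} by move=> d e dE eE; apply: (forall_inP (I d dE)).
  have [//|s' [t []//]] := @check_sound n K _ [::] V x0 E
    (fun W' s' p lab' => disjoint_obsP x0 lab' I') W (enum W) [::] _ certI isT
    (wf_all_triples n) lab _ (sE _ lab) KE chI.
rewrite negb_forall_in => /exists_inP[a aE]; rewrite negb_forall_in => /exists_inP[b bE dab].
have [a3 aW] := triples_inP EW aE; have [b3 bW] := triples_inP EW bE.
(* The labels 0, 1, 2 go to [a], the labels 3, 4, 5 to [b]. *)
pose s := enum a ++ enum b ++ enum (W :\: (a :|: b)).
have disj : [disjoint a & b] by rewrite -setI_eq0; move: dab; rewrite negbK.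
have lab : labelling n W s.
  split.
  - rewrite !cat_uniq !enum_uniq /= andbT; apply/andP; split.
      apply/hasPn => x; rewrite mem_cat !mem_enum !inE => /orP[xb|/andP[]]; last by case: (x \in a).
      by apply/negP => /(disjointFr disj); rewrite xb.
    by apply/hasPn => x; rewrite !mem_enum !inE => /andP[]; case: (x \in b); rewrite ?orbT.
  - rewrite !size_cat -!cardE a3 b3 cardsD (setIidPr _) ?subUset ?aW // cardsU a3 b3.
    by move: disj; rewrite -setI_eq0 => /eqP ->; rewrite cards0 Wn; lia.
  - move=> x; rewrite !mem_cat !mem_enum !inE.
    have := subsetP aW x; have := subsetP bW x.
    by case: (x \in a) (x \in b) (x \in W) => [] [] [] //= bW' aW';
      first [by have := bW' isT | by have := aW' isT].
have pl (c : {set V}) (u v : seq V) (k : nat) : s = u ++ enum c ++ v -> size u = k -> #|c| = 3 ->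
    place x0 s [:: k; k.+1; k.+2] = c.
  move=> -> <- c3.
  have sh w i : nth x0 (u ++ w) (i + size u) = nth x0 w i.
    by rewrite nth_cat ltnNge leq_addl addnK.
  have := mem_enum c; rewrite cardE in c3.
  case: (enum c) c3 => [|x [|y [|z [|? ?]]]] //= _ me; apply/setP => w.
  by rewrite -me !inE (sh _ 0) (sh _ 1) (sh _ 2).
have basePE c : c \in base_pair -> place x0 s c \in E.
  rewrite !inE => /orP[]/eqP->.
    by rewrite (pl a [::] (enum b ++ enum (W :\: (a :|: b)))).
  by rewrite (pl b (enum a) (enum (W :\: (a :|: b)))) // -cardE.
have [|s' [t H]] := @check_sound n K _ targets V x0 E
    (fun W' s' p lab' => path_obsP x0 lab' F) W s base_pair _ certP _
    (wf_all_triples n) lab basePE (sE _ lab) KE chP; last by exists x0, s', t.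
by rewrite /base_pair /wf /= !andbT !(leq_trans _ n6).
Qed.

(** * Cographs *)

Section Cographs.
Variable T : finType.
Implicit Types (r : rel T) (A B : {set T}).

(** The graph [r] is disconnected on [A], with [B] a nonempty proper union of components. *)
Definition splits r A := exists2 B : {set T}, [/\ B \subset A, B != set0 & A :\: B != set0] &
  forall x y, x \in B -> y \in A :\: B -> ~~ r x y.

Definition no_induced_path r A := forall a b c d,
  [/\ a \in A, b \in A, c \in A & d \in A] -> uniq [:: a; b; c; d] ->
  ~~ [&& r a b, r b c, r c d, ~~ r a c, ~~ r a d & ~~ r b d].

Definition corel r : rel T := fun x y => ~~ r x y.

(** The path on four vertices is self-complementary: the complement of a, b, c, d is the path c, a,
    d, b. *)
Lemma corel_no_induced_path r A : symmetric r ->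
  no_induced_path r A -> no_induced_path (corel r) A.
Proof.
move=> rC F a b c d [aA bA cA dA] U; apply/negP.
rewrite /corel !negbK => /and5P[ab bc cd ac /andP[ad bd]].
have /negP[] : ~~ [&& r c a, r a d, r d b, ~~ r c d, ~~ r c b & ~~ r a b].
  by apply: F => //; move: U; rewrite /= !inE; do 6! case: eqVneq => // _.
by rewrite (rC c a) (rC d b) (rC c b) ac ad bd cd bc ab.
Qed.

(** If [x] has no neighbour in [A' :\: B], this side stays separated. Otherwise it has a neighbour
    [w] there, and the non-neighbours of [x] in [B], of which [y0] is one, split off from everything
    else. *)
Lemma splits_extend_aux r A x B y0 : symmetric r -> no_induced_path r A -> x \in A ->
  let A' := A :\ x in
  [/\ B \subset A', B != set0 & A' :\: B != set0] ->
  (forall y z, y \in B -> z \in A' :\: B -> ~~ r y z) ->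
  y0 \in B -> ~~ r x y0 -> splits r A.
Proof.
move=> rC F xA A' [/subsetP BA Bn Cn] BC y0B xy0.
have BA' y : y \in B -> (y != x) && (y \in A) by move/BA; rewrite !inE.
case: (boolP [forall w in A' :\: B, ~~ r x w]) => [/forall_inP noC|].
  exists (A' :\: B).
    split=> //; first by apply/subsetP => y; rewrite !inE => /and3P[].
    by apply/set0Pn; exists x; rewrite !inE eqxx xA andbF.
  move=> y z yC; rewrite !inE negb_and negbK => /andP[+ zA].
  rewrite zA andbT => /orP[zB|]; first by rewrite rC BC.
  by rewrite negbK => /eqP->; rewrite rC noC.
rewrite negb_forall_in => /exists_inP[w wC]; rewrite negbK => xw.
have := wC; rewrite !inE => /and3P[wB wx wA].
exists [set y in B | ~~ r x y].
  split; first by apply/subsetP => y; rewrite inE => /andP[/BA' /andP[]].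
    by apply/set0Pn; exists y0; rewrite inE y0B.
  by apply/set0Pn; exists x; rewrite !inE xA andbT; apply/negP => /andP[/BA']; rewrite eqxx.
move=> y z; rewrite !inE => /andP[yB xy] /andP[]; rewrite negb_and negbK => zB zA.
have [->|zx] := eqVneq z x; first by rewrite (rC y).
have [zinB|zninB] := boolP (z \in B); last by rewrite BC // !inE zninB zx.
rewrite zinB /= in zB; apply/negP => yz.
have [/andP[yx yA] _] := (BA' y yB, 0).
(* A neighbour [z] of [x] in [B] adjacent to the non-neighbour [y] would give the induced path w, x,
   z, y. *)
have /negP[] : ~~ [&& r w x, r x z, r z y, ~~ r w z, ~~ r w y & ~~ r x y].
  apply: F => //=; rewrite !inE !negb_or wx [x == z]eq_sym zx [x == y]eq_sym yx /= andbT.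
  rewrite -andbA; apply/and3P; split; last by apply: contraNneq xy => <-.
    by apply: contraNneq wB => ->.
  by apply: contraNneq wB => ->.
by rewrite (rC w x) xw zB (rC z y) yz (rC w z) BC // (rC w y) BC.
Qed.

(** A vertex adjacent to all others splits off in the complement. Otherwise it has a non-neighbour
    on one of the two sides, and the sides are interchangeable. *)
Lemma splits_extend r A x : symmetric r -> no_induced_path r A -> x \in A ->
  splits r (A :\ x) -> splits r A \/ splits (corel r) A.
Proof.
move=> rC F xA [B [BA Bn Cn] BC].
case: (boolP [forall y in A :\ x, r x y]) => [/forall_inP al|].
  right; exists [set x].
    split; first by rewrite sub1set.
      by apply/set0Pn; exists x; rewrite inE.
    case/set0Pn: Bn => y /(subsetP BA) yA; apply/set0Pn; exists y; exact: yA.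
  by move=> y z; rewrite inE => /eqP-> /al; rewrite /corel negbK.
rewrite negb_forall_in => /exists_inP[y yA xy]; left.
have [yB|yB] := boolP (y \in B); first exact: splits_extend_aux rC F xA (And3 BA Bn Cn) BC yB xy.
apply: (splits_extend_aux (x := x) (B := (A :\ x) :\: B) (y0 := y)) => //.
- by split=> //; rewrite ?subsetDl // setDDr setDv set0U (setIidPr BA).
- by move=> u v uC; rewrite setDDr setDv set0U => /setIP[_ vB]; rewrite rC BC.
- by rewrite inE yB.
Qed.

(** Seinsche's theorem, by removing a vertex. If the rest is split in the complement, the extension
    step is applied to [corel r], which is again free of induced paths. *)
Lemma cograph_splits r A : symmetric r -> no_induced_path r A -> 1 < #|A| ->
  splits r A \/ splits (corel r) A.
Proof.
move=> rC; move: {2}#|A| (leqnn #|A|) => m.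
elim: m A => [|m IH] A Am F A1; first by lia.
have /card_gt0P[x xA] : 0 < #|A| by lia.
have cA := cardsD1 x A; rewrite xA in cA.
have [A'1|A'1] := ltnP 1 #|A :\ x|; last first.
  have /cards1P[y Ay] : #|A :\ x| == 1 by apply/eqP; lia.
  have yA : y \in A :\ x by rewrite Ay inE.
  have sp r' : ~~ r' x y -> splits r' A.
    move=> xy; exists [set x]; last by move=> u v; rewrite Ay !inE => /eqP-> /eqP->.
    rewrite sub1set xA Ay; split=> //; apply/set0Pn; [exists x | exists y]; exact: set11.
  have [xy|xy] := boolP (r x y); [right | left]; apply: sp => //.
  by rewrite /corel negbK.
have F' : no_induced_path r (A :\ x).
  by move=> a b c d []; rewrite !inE => /andP[_ ?] /andP[_ ?] /andP[_ ?] /andP[_ ?]; apply: F.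
have ltm : #|A :\ x| <= m by lia.
have [|sp] := IH _ ltm F' A'1; first exact: splits_extend.
have coC : symmetric (corel r) by move=> u v; rewrite /corel rC.
have [|[B ? BC]] := splits_extend coC (corel_no_induced_path rC F) xA sp; first by right.
left; exists B => // u v uB vB.
by have := BC u v uB vB; rewrite /corel negbK.
Qed.
End Cographs.

(** * Two disjoint parts of a non-intersecting edge set *)

Section Decompose.
Variables (V : finType) (E : {set {set V}}).
Hypothesis F : P4free E.

Record decomposition (D1 D2 : {set {set V}}) : Prop := Decomposition {
  dec_sub1 : D1 \subset E;
  dec_sub2 : D2 \subset E;
  dec_ne1 : D1 != set0;
  dec_ne2 : D2 != set0;
  dec_disj : forall d1 d2, d1 \in D1 -> d2 \in D2 -> ~~ meets d1 d2;
  dec_meet : forall f, f \in E -> f \notin D1 -> f \notin D2 ->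
    forall d, (d \in D1) || (d \in D2) -> meets f d
}.

Lemma decomposition_sym D1 D2 : decomposition D1 D2 -> decomposition D2 D1.
Proof.
case=> s1 s2 n1 n2 dj mt; split=> //.
  by move=> d1 d2 dD1 dD2; rewrite meetsC dj.
by move=> f fE f2 f1 d dD; apply: mt; rewrite 1?orbC.
Qed.

(** A descent in the cotree. The invariant is a set [D] containing [a] and [b] such that every edge
    outside [D] meets every edge of [D]. If the intersection graph on [D] is disconnected, its two
    sides are the parts. If the complement is disconnected, edges on different sides meet, so the
    disjoint edges [a] and [b] are on the same side, which is a smaller [D]. *)
Lemma decomposition_exists a b : a != set0 -> a \in E -> b \in E -> ~~ meets a b ->
  exists D1 D2, decomposition D1 D2.
Proof.
move=> an aE bE ab.
suff H m (D : {set {set V}}) : #|D| <= m -> D \subset E -> a \in D -> b \in D ->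
    (forall f d, f \in E -> f \notin D -> d \in D -> meets f d) ->
    exists D1 D2, decomposition D1 D2.
  by apply: (H _ E (leqnn _)) => // f d fE; rewrite fE.
elim: m D => [|m IH] D Dm DE aD bD DM.
  by move: Dm; rewrite leqn0 cards_eq0 => /eqP D0; rewrite D0 inE in aD.
have D2 : 1 < #|D|.
  have nab : a != b by apply: contraNneq ab => <-; rewrite /meets setIid.
  apply: leq_trans (_ : #|[set a; b]| <= _); first by rewrite cards2 nab.
  by rewrite subset_leq_card // subUset !sub1set aD.
have FD : no_induced_path (@meets V) D.
  move=> p q s t [pD qD sD tD] _; apply: F; exact: (subsetP DE).
have [[B [BD Bn Cn] BC]|[B [BD Bn Cn] BC]] := cograph_splits (@meetsC V) FD D2.
  exists B, (D :\: B); split=> //; first exact: subset_trans BD DE.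
    by apply: subset_trans DE; rewrite subsetDl.
  move=> f fE fB fC d dD; apply: DM => //.
    by move: fC; rewrite inE fB.
  by move: dD; rewrite inE => /orP[/(subsetP BD)|/andP[]].
have crs u v : u \in B -> v \in D -> v \notin B -> meets u v.
  by move=> uB vD vB; have := BC u v uB; rewrite inE vB vD => /(_ isT); rewrite /corel negbK.
have cD := cardsID B D; rewrite (setIidPr BD) in cD.
have [Bm Cm] : #|B| <= m /\ #|D :\: B| <= m.
  move: Dm Bn Cn; rewrite -cD -!card_gt0; move: #|B| #|D :\: B| => i j; lia.
have [aB|aB] := boolP (a \in B).
  have bB : b \in B by apply: contraNT ab => bB; apply: crs.
  apply: (IH B) => //; first exact: subset_trans BD DE.
  move=> f d fE fB dB; have [fD|fD] := boolP (f \in D); first by rewrite meetsC crs.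
  by apply: DM => //; apply: (subsetP BD).
have bB : b \notin B by apply: contra ab => bB; rewrite meetsC crs.
apply: (IH (D :\: B)); rewrite ?inE ?aB ?bB //.
- by apply: subset_trans DE; rewrite subsetDl.
move=> f d fE; rewrite !inE negb_and negbK => fD /andP[dB dD].
case/orP: fD => [fB|fD]; first exact: crs.
exact: DM.
Qed.
End Decompose.

(** * Degrees *)

Section Pairs.
Variable V : finType.
Implicit Types (A B p d e g h : {set V}) (D : {set {set V}}).

Definition pairs A B : {set {set V}} := [set [set q.1; q.2] | q in setX A B].

Lemma card_pairs A B : #|pairs A B| <= #|A| * #|B|.
Proof. by rewrite -cardsX leq_imset_card. Qed.

Lemma mem_pairs A B x y : x \in A -> y \in B -> [set x; y] \in pairs A B.
Proof. by move=> xA yB; apply/imsetP; exists (x, y); rewrite // inE /= xA. Qed.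

Lemma card2_eq p x y : #|p| = 2 -> x \in p -> y \in p -> x != y -> p = [set x; y].
Proof.
move=> p2 xp yp xy; apply/esym/eqP.
by rewrite eqEcard subUset !sub1set xp yp cards2 xy p2.
Qed.

Lemma triple_pair e u : #|e| = 3 -> u \in e -> #|e :\ u| = 2.
Proof. by move=> e3 ue; have := cardsD1 u e; rewrite e3 ue => -[]. Qed.

Lemma mem_pairs_triple e u x y A B : #|e| = 3 ->
  u \in e -> x \in e -> y \in e -> x != u -> y != u -> x != y ->
  x \in A -> y \in B -> e :\ u \in pairs A B.
Proof.
move=> e3 ue xe ye xu yu xy xA yB.
by rewrite (card2_eq (triple_pair e3 ue) _ _ xy) ?mem_pairs // !inE ?xu ?yu.
Qed.

Definition degree D u := #|[set e in D | u \in e]|.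

(** Deleting [u] is injective on the edges through [u]: degrees are bounded by counting pairs in the
    link of [u]. *)
Lemma degree_le D (T : {set {set V}}) u :
  (forall e, e \in D -> u \in e -> e :\ u \in T) -> degree D u <= #|T|.
Proof.
move=> H; rewrite /degree -(@card_in_imset _ _ (fun e => e :\ u) (mem [set e in D | u \in e])).
  by apply/subset_leq_card/subsetP => _ /imsetP[e + ->]; rewrite inE => /andP[]; apply: H.
move=> e e'; rewrite !inE => /andP[_ ue] /andP[_ ue'] eq.
by rewrite -(setD1K ue) -(setD1K ue') eq.
Qed.

Definition common D := [set x : V | [forall d in D, x \in d]].

Lemma commonP D x : reflect (forall d, d \in D -> x \in d) (x \in common D).
Proof. by rewrite inE; apply: forall_inP. Qed.

Lemma commonPn D x : x \notin common D -> exists2 d, d \in D & x \notin d.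
Proof. by rewrite inE negb_forall_in => /exists_inP. Qed.

Lemma common_sub D d : d \in D -> common D \subset d.
Proof. by move=> dD; apply/subsetP => x /commonP; apply. Qed.

Lemma coverP D x : reflect (exists2 d, d \in D & x \in d) (x \in cover D).
Proof. exact: bigcupP. Qed.

Definition hitting_pairs (s : seq {set V}) :=
  [set p : {set V} | (#|p| == 2) && all (meets p) s].

(** As no vertex is common to [D], each vertex shared by [g] and [h] is avoided by an edge, taken as
    [k] or [l]. A hitting pair through the shared vertex then needs its second vertex in that edge,
    which leaves three choices. *)
Lemma pair_hitting_few D g h : (forall d, d \in D -> #|d| = 3) -> common D = set0 ->
  g \in D -> h \in D -> g != h -> meets g h ->
  exists k l, [/\ k \in D, l \in D &
    #|hitting_pairs [:: g; h; k; l]| <= 7].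
Proof.
move=> D3 D0 gD hD gh /meetsP[s sg sh].
have av x : exists2 d, d \in D & x \notin d by apply: commonPn; rewrite D0 inE.
have [k kD sk] := av s.
have g2 := triple_pair (D3 g gD) sg; have h2 := triple_pair (D3 h hD) sh.
have with_s x p d : #|p| = 2 -> meets p d -> x \in p -> x \notin d -> p \in pairs [set x] d.
  move=> p2 /meetsP[y yp yd] xp xd; rewrite (card2_eq p2 xp yp) ?mem_pairs ?set11 //.
  by apply: contraNneq xd => ->.
have [dis|/negPn/meetsP[t tg th]] := boolP (~~ meets (g :\ s) (h :\ s)).
  (* Here [g] and [h] share only [s]: at most 3 pairs through [s] and 2 * 2 pairs avoiding it. *)
  exists k, k; split=> //.
  apply: leq_trans (_ : #|pairs [set s] k :|: pairs (g :\ s) (h :\ s)| <= _).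
    apply/subset_leq_card/subsetP => p; rewrite !in_setU inE => /andP[/eqP p2 /and5P[pg ph pk _ _]].
    have [sp|sp] := boolP (s \in p); first by rewrite with_s.
    case/meetsP: pg => x xp xg; case/meetsP: ph => y yp yh; apply/orP; right.
    have xs : x \in g :\ s by rewrite !inE xg andbT; apply: contraNneq sp => <-.
    have ys : y \in h :\ s by rewrite !inE yh andbT; apply: contraNneq sp => <-.
    rewrite (card2_eq p2 xp yp) ?mem_pairs //.
    by apply: contraNneq dis => xy; apply/meetsP; exists x; rewrite // xy.
  apply: leq_trans (leq_card_setU _ _) _.
  have := card_pairs [set s] k; have := card_pairs (g :\ s) (h :\ s).
  by rewrite cards1 g2 h2 (D3 k kD) => c1 c2; rewrite (leq_add c2 c1).
have [l lD tl] := av t.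
(* Here [g] and [h] share [s] and [t]: at most 3 pairs through each, and one pair formed by the two
   remaining vertices, which differ since [g] and [h] do. *)
exists k, l; split=> //.
have g1 : #|g :\ s :\ t| = 1 by have := cardsD1 t (g :\ s); rewrite g2 tg => -[].
have h1 : #|h :\ s :\ t| = 1 by have := cardsD1 t (h :\ s); rewrite h2 th => -[].
apply: leq_trans (_ : #|pairs [set s] k :|: pairs [set t] l :|: pairs (g :\ s :\ t) (h :\ s :\ t)| <= _).
  apply/subset_leq_card/subsetP => p; rewrite !in_setU inE => /andP[/eqP p2 /and5P[pg ph pk pl _]].
  have [sp|sp] := boolP (s \in p); first by rewrite with_s.
  have [tp|tp] := boolP (t \in p); first by rewrite (with_s t p l) ?orbT.
  case/meetsP: pg => x xp xg; case/meetsP: ph => y yp yh; apply/orP; right.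
  have xs : x \in g :\ s :\ t.
    by rewrite !inE xg andbT; apply/andP; split; [apply: contraNneq tp | apply: contraNneq sp] => <-.
  have ys : y \in h :\ s :\ t.
    by rewrite !inE yh andbT; apply/andP; split; [apply: contraNneq tp | apply: contraNneq sp] => <-.
  rewrite (card2_eq p2 xp yp) ?mem_pairs //.
  apply: contraNneq gh => xy; rewrite -xy in ys.
  have gx : g :\ s :\ t = [set x].
    by apply/eqP; rewrite eq_sym eqEcard sub1set xs cards1 g1.
  have hx : h :\ s :\ t = [set x].
    by apply/eqP; rewrite eq_sym eqEcard sub1set ys cards1 h1.
  by rewrite -(setD1K sg) -(setD1K sh) -(setD1K tg) -(setD1K th) gx hx.
apply: leq_trans (leq_card_setU _ _) _.
have := card_pairs (g :\ s :\ t) (h :\ s :\ t); rewrite g1 h1 => c3.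
apply: leq_trans (leq_add (leq_card_setU _ _) c3) _.
have := card_pairs [set s] k; have := card_pairs [set t] l.
by rewrite !cards1 (D3 k kD) (D3 l lD) => c1 c2; rewrite (leq_add (leq_add c2 c1) (leqnn _)).
Qed.

(** An edge [d1] holds a common vertex [c] and two more vertices; either of these that is not common
    is missed by some edge. *)
Lemma common_three D : (forall d, d \in D -> #|d| = 3) -> D != set0 -> common D != set0 ->
  exists d1 d2 d3, [/\ d1 \in D, d2 \in D, d3 \in D & d1 :&: d2 :&: d3 \subset common D].
Proof.
move=> D3 /set0Pn[d1 dD] /set0Pn[c cC].
have cd : c \in d1 by move/commonP: cC; apply.
have /cards2P[x [y [xy dxy]]] : #|d1 :\ c| == 2 by rewrite (triple_pair (D3 _ dD) cd).
have pick x0 : exists d, d \in D /\ (x0 \in d -> x0 \in common D).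
  have [xC|/commonPn[d dD' xd]] := boolP (x0 \in common D); first by exists d1.
  by exists d; rewrite (negbTE xd).
have [d2 [d2D xd2]] := pick x; have [d3 [d3D yd3]] := pick y.
exists d1, d2, d3; split=> //; apply/subsetP => z; rewrite !inE => /andP[/andP[z1 z2] z3].
have [->|zc] := eqVneq z c; first by move: cC; rewrite inE.
have : z \in d1 :\ c by rewrite !inE zc.
rewrite dxy !inE => /orP[]/eqP ez; subst z; first by move: (xd2 z2); rewrite inE.
by move: (yd3 z3); rewrite inE.
Qed.

(** The three edges of [common_three] share a vertex, so they cover at most 3 + 2 + 2 = 7 vertices,
    and an eighth vertex [u] lies in none of them. A vertex that together with [u] hits all edges
    must then lie in all three. *)
Lemma star_low_cover D : (forall d, d \in D -> #|d| = 3) -> D != set0 -> common D != set0 ->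
  8 <= #|cover D| ->
  exists2 u, u \in cover D :\: common D &
    forall z, (forall d, d \in D -> (u \in d) || (z \in d)) -> z \in common D.
Proof.
move=> D3 Dn Cn cD; have [d1 [d2 [d3 [d1D d2D d3D sC]]]] := common_three D3 Dn Cn.
have /set0Pn[c cC] := Cn.
have cm d : d \in D -> c \in d by move/commonP: cC; apply.
have le2 A d : d \in D -> c \in A -> #|A :|: d| <= #|A| + 2.
  move=> dD cA; rewrite -(triple_pair (D3 d dD) (cm d dD)).
  apply: leq_trans (leq_card_setU A (d :\ c)); apply/subset_leq_card/subsetP => z.
  by rewrite !inE; case: eqVneq => // ->; rewrite cA.
have U7 : #|d1 :|: d2 :|: d3| <= 7.
  apply: leq_trans (le2 _ _ d3D _) _; first by rewrite inE cm.
  by rewrite (leq_add2r 2 _ 5) (leq_trans (le2 _ _ d2D _)) ?cm // (D3 d1 d1D).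
have [|u uD uU] := @subsetPn _ (mem (cover D)) (mem (d1 :|: d2 :|: d3)) _.
  apply/negP => /subset_leq_card; apply/negP; rewrite -ltnNge.
  exact: leq_ltn_trans U7 _.
move: uU; rewrite !inE !negb_or => /andP[/andP[u1 u2] u3].
exists u; first by rewrite inE uD andbT; apply: contra u1 => /commonP; apply.
move=> z H; apply: (subsetP sC); rewrite !inE.
have := H _ d1D; have := H _ d2D; have := H _ d3D.
by rewrite (negbTE u1) (negbTE u2) (negbTE u3) /= => -> -> ->.
Qed.
End Pairs.

(** * Degrees in an edge set with two disjoint parts *)

Section LowDegree.
Variables (V : finType) (W : {set V}) (E : {set {set V}}).
Hypotheses (EW : E \subset triples_in W) (F : P4free E).

Let E3 (d : {set V}) : d \in E -> #|d| = 3.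
Proof. by case/(triples_inP EW). Qed.

Let EsW (d : {set V}) : d \in E -> d \subset W.
Proof. by case/(triples_inP EW). Qed.

Section Decomposed.
Variables D1 D2 : {set {set V}}.
Hypothesis dec : decomposition E D1 D2.

Let C1 := common D1.
Let C2 := common D2.
Let V1 := cover D1.
Let V2 := cover D2.

Lemma dec_card1 d : d \in D1 -> #|d| = 3.
Proof. by move/(subsetP (dec_sub1 dec))/E3. Qed.

Lemma dec_card2 d : d \in D2 -> #|d| = 3.
Proof. by move/(subsetP (dec_sub2 dec))/E3. Qed.

Lemma card_common : #|C1| <= 3.
Proof.
have /set0Pn[d dD] := dec_ne1 dec.
by rewrite -(dec_card1 dD) subset_leq_card // common_sub.
Qed.

Lemma cover_disjoint : V1 :&: V2 = set0.
Proof.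
apply/eqP/negPn; apply/negP => /set0Pn[x /setIP[/coverP[d1 d1D x1] /coverP[d2 d2D x2]]].
by have /meetsP[] := dec_disj dec d1D d2D; exists x.
Qed.

Lemma cover_subW : V1 \subset W.
Proof.
by apply/subsetP => x /coverP[d /(subsetP (dec_sub1 dec))/EsW/subsetP dW /dW].
Qed.

Lemma crossing_meets f : f \in E -> f \notin D1 -> f \notin D2 ->
  (exists2 x, x \in f & x \in V1) /\ (exists2 y, y \in f & y \in V2).
Proof.
move=> fE f1 f2; split.
  have /set0Pn[d dD] := dec_ne1 dec.
  have /meetsP[x xf xd] : meets f d by apply: dec_meet dec _ _ _ _ _ _; rewrite // dD.
  by exists x => //; apply/coverP; exists d.
have /set0Pn[d dD] := dec_ne2 dec.
have /meetsP[x xf xd] : meets f d by apply: dec_meet dec _ _ _ _ _ _; rewrite // dD orbT.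
by exists x => //; apply/coverP; exists d.
Qed.

Lemma crossing_single f x : f \in E -> f \notin D1 -> f \notin D2 ->
  (forall z, z \in f -> z \in V1 -> z = x) -> x \in C1.
Proof.
move=> fE f1 f2 H; apply/commonP => d dD.
have /meetsP[z zf zd] : meets f d by apply: dec_meet dec _ _ _ _ _ _; rewrite // dD.
by rewrite -(H z zf) //; apply/coverP; exists d.
Qed.

Lemma notin_dec u (e : {set V}) : u \in e -> u \notin V1 -> e \notin D1.
Proof. by move=> ue; apply: contra => eD; apply/coverP; exists e. Qed.

End Decomposed.

(** The other two vertices of an edge through [u] lie one in each cover; each is alone there and
    therefore common to its part. *)
Lemma degree_outside D1 D2 u : decomposition E D1 D2 ->
  u \notin cover D1 -> u \notin cover D2 -> degree E u <= #|common D1| * #|common D2|.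
Proof.
move=> dec u1 u2; apply: leq_trans (card_pairs _ _); apply: degree_le => e eE ue.
have e1 := notin_dec ue u1; have e2 := notin_dec ue u2.
have [[x xe x1] [y ye y2]] := crossing_meets dec eE e1 e2.
have xy : x != y.
  apply: contraTneq x1 => ->; apply/negP => y1.
  by have := in_set0 y; rewrite -(cover_disjoint dec) inE y1 y2.
have xu : x != u by apply: contraTneq x1 => ->.
have yu : y != u by apply: contraTneq y2 => ->.
have euv : e :\ u = [set x; y].
  by apply: (card2_eq _ _ _ xy); rewrite ?triple_pair ?E3 // !inE ?xu ?yu.
have mem z : z \in e -> [\/ z = u, z = x | z = y].
  move=> ze; have [->|zu] := eqVneq z u; first by constructor.
  have : z \in e :\ u by rewrite !inE zu.
  by rewrite euv !inE => /orP[]/eqP->; constructor.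
rewrite euv mem_pairs //.
  apply: (crossing_single dec eE e1 e2) => z /mem[] -> // zV; first by rewrite zV in u1.
  by have := in_set0 y; rewrite -(cover_disjoint dec) inE zV y2.
apply: (crossing_single (decomposition_sym dec) eE e2 e1) => z /mem[] -> // zV.
  by rewrite zV in u2.
by have := in_set0 x; rewrite -(cover_disjoint dec) inE zV x1.
Qed.

Definition covering_partners (D : {set {set V}}) u :=
  [set z : V | (z != u) && [forall d in D, (u \in d) || (z \in d)]].

Lemma degree_split (D : {set {set V}}) u :
  degree E u <= degree D u + degree (E :\: D) u.
Proof.
apply: leq_trans (leq_card_setU _ _).
apply/subset_leq_card/subsetP => e; rewrite !inE => /andP[-> ->].
by case: (e \in D).
Qed.

(** An edge through [u] outside [D1] has a vertex in the cover of [D2]. Since [u] is not common to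
    [D1], it is not alone in the cover of [D1], so the third vertex is also there, and the two
    together hit all of [D1]. The vertex on the other side is alone, hence common to [D2]. *)
Lemma degree_inside D1 D2 u : decomposition E D1 D2 ->
  u \in cover D1 -> u \notin common D1 ->
  degree E u <= degree D1 u + #|covering_partners D1 u| * #|common D2|.
Proof.
move=> dec u1 uC; apply: leq_trans (degree_split D1 u) _; rewrite leq_add2l.
apply: leq_trans (card_pairs _ _); apply: degree_le => e /setDP[eE e1] ue.
have nV x : x \in cover D1 -> x \in cover D2 -> False.
  by move=> x1 x2; have := in_set0 x; rewrite -(cover_disjoint dec) inE x1 x2.
have e2 : e \notin D2 by apply/negP => eD; apply: (nV u) => //; apply/coverP; exists e.
have [_ [y ye y2]] := crossing_meets dec eE e1 e2.
have [z [ze zu z1]] : exists z, [/\ z \in e, z != u & z \in cover D1].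
  have [/exists_inP[z ze /andP[]]|none] := boolP [exists z in e, (z != u) && (z \in cover D1)].
    by exists z.
  case/negP: uC; apply: (crossing_single dec eE e1 e2) => z ze z1.
  by apply: contraNeq none => zu; apply/exists_inP; exists z; rewrite // zu.
have yu : y != u by apply/eqP => yu; apply: (nV u) => //; rewrite -yu.
have zy : z != y by apply/eqP => zy; apply: (nV y) => //; rewrite -zy.
have euv : e :\ u = [set z; y].
  by apply: (card2_eq _ _ _ zy); rewrite ?triple_pair ?E3 // !inE ?zu ?yu.
have mem w : w \in e -> [\/ w = u, w = z | w = y].
  move=> we; have [->|wu] := eqVneq w u; first by constructor.
  have : w \in e :\ u by rewrite !inE wu.
  by rewrite euv !inE => /orP[]/eqP->; constructor.
rewrite euv mem_pairs //.
  rewrite inE zu; apply/forall_inP => d dD.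
  have /meetsP[w /mem[]-> wd] : meets e d by apply: dec_meet dec _ _ _ _ _ _; rewrite // dD.
  - by rewrite wd.
  - by rewrite wd orbT.
  by case: (nV y) => //; apply/coverP; exists d.
apply: (crossing_single (decomposition_sym dec) eE e2 e1) => w /mem[]-> // w2.
  by case: (nV u).
by case: (nV z).
Qed.

(** Some edge of [D1] misses [u], and every partner must lie in it. *)
Lemma card_covering_partners D1 D2 u : decomposition E D1 D2 -> u \notin common D1 ->
  #|covering_partners D1 u| <= 3.
Proof.
move=> dec /commonPn[d dD ud]; rewrite -(dec_card1 dec dD).
apply/subset_leq_card/subsetP => z; rewrite inE => /andP[_ /forall_inP/(_ d dD)].
by rewrite (negbTE ud).
Qed.

(** An edge through [u] can only be [u] with the two common vertices. *)
Lemma degree_two_common (D : {set {set V}}) u : D \subset E -> #|common D| = 2 ->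
  u \notin common D -> degree D u <= 1.
Proof.
move=> DE C2 uC; rewrite -(cards1 (common D)); apply: degree_le => e eD ue.
rewrite inE eq_sym eqEcard (triple_pair (E3 (subsetP DE _ eD)) ue) C2 leqnn andbT.
apply/subsetP => x xC; rewrite !inE (subsetP (common_sub eD)) // andbT.
by apply: contraNneq uC => <-.
Qed.

(** An edge through [u] also contains the common vertex [v], so only its third vertex is free. *)
Lemma degree_one_common (D : {set {set V}}) u : D \subset E -> common D != set0 ->
  u \in cover D -> u \notin common D -> degree D u <= #|cover D| - 2.
Proof.
move=> DE /set0Pn[v vC] uV uC.
have vu : v != u by apply: contraNneq uC => <-.
have -> : #|cover D| - 2 = #|cover D :\ u :\ v|.
  have vV : v \in cover D.
    by have /coverP[d dD _] := uV; apply/coverP; exists d => //; move/commonP: vC; apply.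
  by have := cardsD1 u (cover D); have := cardsD1 v (cover D :\ u); rewrite uV !inE vu vV /=; lia.
rewrite -[X in _ <= X]mul1n -(cards1 v); apply: leq_trans (card_pairs _ _).
apply: degree_le => e eD ue; have ve : v \in e by move/commonP: vC; apply.
have e2 := triple_pair (E3 (subsetP DE _ eD)) ue.
have /card_gt0P[y] : 0 < #|e :\ u :\ v|.
  by have := cardsD1 v (e :\ u); rewrite e2 !inE vu ve /=; lia.
rewrite !inE => /and3P[yv yu ye].
apply: (mem_pairs_triple (E3 (subsetP DE _ eD)) ue ve ye) => //; first by rewrite eq_sym.
  by rewrite inE.
by rewrite !inE yv yu; apply/coverP; exists e.
Qed.

Lemma exists_noncommon D1 D2 : decomposition E D1 D2 -> #|common D1| <= 2 ->
  exists2 u, u \in cover D1 & u \notin common D1.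
Proof.
move=> dec C2; have /set0Pn[d dD] := dec_ne1 dec.
have /subsetPn[u ud uC] : ~~ (d \subset common D1).
  by apply/negP => /subset_leq_card; rewrite (dec_card1 dec dD) leqNgt ltnS C2.
by exists u => //; apply/coverP; exists d.
Qed.

Lemma cover_common3 D1 D2 : decomposition E D1 D2 -> #|common D1| = 3 ->
  cover D1 = common D1 /\ D1 = [set common D1].
Proof.
move=> dec C3.
have all_eq d : d \in D1 -> d = common D1.
  by move=> dD; apply/eqP; rewrite eq_sym eqEcard common_sub // (dec_card1 dec dD) C3.
have /set0Pn[d dD] := dec_ne1 dec.
have D1E : D1 = [set common D1].
  apply/setP => e; rewrite inE; apply/idP/eqP => [/all_eq //|->].
  by rewrite -(all_eq d dD).
split=> //; apply/setP => x; apply/coverP/idP => [[e /all_eq->]//|xC].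
by exists d; rewrite // (all_eq d dD).
Qed.

End LowDegree.

(** * A vertex of degree at most n - 2 when there are at least 11 vertices *)

Section ExistsLowDegree.
Variables (V : finType) (W : {set V}) (E : {set {set V}}).
Hypotheses (EW : E \subset triples_in W) (F : P4free E).
Hypothesis W11 : 11 <= #|W|.

Let E3 (d : {set V}) : d \in E -> #|d| = 3.
Proof. by case/(triples_inP EW). Qed.

Let EsW (d : {set V}) : d \in E -> d \subset W.
Proof. by case/(triples_inP EW). Qed.

(** Since [u] lies outside the sets of [s], the other two vertices of an edge through [u] must do
    all the meeting. *)
Lemma degree_hitting (D : {set {set V}}) (s : seq {set V}) u : D \subset E ->
  (forall e d, e \in D -> u \in e -> d \in s -> meets e d /\ u \notin d) ->
  degree D u <= #|hitting_pairs s|.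
Proof.
move=> /subsetP DE H; apply: degree_le => e eE ue.
rewrite inE (triple_pair (E3 (DE _ eE)) ue) eqxx; apply/allP => d ds.
have [/meetsP[x xe xd] ud] := H e d eE ue ds.
by apply/meetsP; exists x => //; rewrite !inE xe andbT; apply: contraNneq ud => <-.
Qed.

Lemma card_star x : x \in common E -> #|E| <= 'C(#|W|.-1, 2).
Proof.
move=> xC; have [->|/set0Pn[e0 e0E]] := eqVneq E set0; first by rewrite cards0.
have xe e : e \in E -> x \in e by move/commonP: xC; apply.
have xW : x \in W := subsetP (EsW e0E) _ (xe _ e0E).
have -> : #|W|.-1 = #|W :\ x| by have := cardsD1 x W; rewrite xW => ->.
rewrite -cards_draws; apply: leq_trans (_ : degree E x <= _).
  by apply/subset_leq_card/subsetP => e eE; rewrite inE eE xe.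
by apply: degree_le => e eE ue; rewrite inE (triple_pair (E3 eE) ue) eqxx setSD ?EsW.
Qed.

Lemma intersecting_low_degree : {in E &, forall d e, meets d e} -> 'C(#|W|.-1, 2) < #|E| ->
  exists2 w, w \in W & degree E w <= #|W| - 2.
Proof.
move=> I big.
have E0 : common E = set0.
  by apply/eqP/negPn/negP => /set0Pn[x /card_star]; rewrite leqNgt big.
have /card_gt1P[g [h [gE hE gh]]] : 1 < #|E|.
  apply: leq_trans big; rewrite ltnS bin_gt0; lia.
have [k [l [kE lE few]]] := pair_hitting_few E3 E0 gE hE gh (I _ _ gE hE).
have cU (A d : {set V}) x : x \in A -> x \in d -> d \in E -> #|A :|: d| <= #|A| + 2.
  move=> xA xd dE; rewrite -(triple_pair (E3 dE) xd).
  apply: leq_trans (leq_card_setU A (d :\ x)); apply/subset_leq_card/subsetP => z.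
  by rewrite !inE; case: eqVneq => // ->; rewrite xA.
have mt d : d \in E -> exists2 x, x \in g & x \in d by move=> dE; apply/meetsP/I.
(* Each of [h], [k], [l] meets [g] and adds at most two vertices: 3 + 2 + 2 + 2. *)
have U9 : #|g :|: h :|: k :|: l| <= 9.
  have [x xg xh] := mt h hE; have [y yg yk] := mt k kE; have [z zg zl] := mt l lE.
  apply: leq_trans (cU _ _ z _ zl lE) _; first by rewrite !inE zg.
  rewrite (leq_add2r 2 _ 7); apply: leq_trans (cU _ _ y _ yk kE) _; first by rewrite inE yg.
  by rewrite (leq_add2r 2 _ 5); apply: leq_trans (cU _ _ x xg xh hE) _; rewrite (E3 gE).
have [u uW uU] : exists2 u, u \in W & u \notin g :|: h :|: k :|: l.
  by apply/subsetPn/negP => /subset_leq_card; lia.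
exists u => //; apply: (@leq_trans 7); last by lia.
apply: leq_trans few; apply: degree_hitting => // e d eE ue.
move: uU; rewrite !inE !negb_or -!andbA => /and4P[ug uh uk ul].
by case/or4P => /eqP->; split; rewrite ?I.
Qed.

Lemma matching_hitting (d1 d2 d3 : {set V}) :
  ~~ meets d1 d2 -> ~~ meets d1 d3 -> ~~ meets d2 d3 -> hitting_pairs [:: d1; d2; d3] = set0.
Proof.
move=> n12 n13 n23; apply/setP => p; rewrite in_set0 inE; apply/negP.
case/andP => /eqP p2 /and4P[/meetsP[x xp x1] /meetsP[y yp y2] /meetsP[z zp z3] _].
have xy : x != y by apply: contraNneq n12 => xy; apply/meetsP; exists x; rewrite // xy.
move: zp; rewrite (card2_eq p2 xp yp xy) !inE => /orP[]/eqP ez; subst z.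
  by case/negP: n13; apply/meetsP; exists x.
by case/negP: n23; apply/meetsP; exists y.
Qed.

(** If two distinct edges meet, [pair_hitting_few] applies. Otherwise the edges are pairwise
    disjoint, covering 7 vertices takes three of them, and no pair hits three disjoint sets. *)
Lemma few_hitting_pairs (D : {set {set V}}) : (forall d, d \in D -> #|d| = 3) ->
  common D = set0 -> 7 <= #|cover D| ->
  exists2 s : seq {set V}, {subset s <= D} & #|hitting_pairs s| <= 7.
Proof.
move=> D3 D0 cD.
have meeting g h : g \in D -> h \in D -> g != h -> meets g h ->
    exists2 s : seq {set V}, {subset s <= D} & #|hitting_pairs s| <= 7.
  move=> gD hD gh mgh; have [k [l [kD lD few]]] := pair_hitting_few D3 D0 gD hD gh mgh.
  by exists [:: g; h; k; l] => // d; rewrite !inE => /or4P[]/eqP->.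
have /card_gt0P[x /coverP[g gD xg]] : 0 < #|cover D| by lia.
have /commonPn[h hD xh] : x \notin common D by rewrite D0 inE.
have gh : g != h by apply: contraTneq xg => ->.
have [/(meeting _ _ gD hD gh)//|ngh] := boolP (meets g h).
have [z /coverP[k kD zk]] : exists2 z, z \in cover D & z \notin g :|: h.
  apply/subsetPn/negP => /subset_leq_card.
  by have := leq_of_leqif (leq_card_setU g h); rewrite (D3 g gD) (D3 h hD); lia.
rewrite inE negb_or => /andP[zg zh].
have gk : g != k by apply: contraNneq zg => ->.
have hk : h != k by apply: contraNneq zh => ->.
have [/(meeting _ _ gD kD gk)//|ngk] := boolP (meets g k).
have [/(meeting _ _ hD kD hk)//|nhk] := boolP (meets h k).
exists [:: g; h; k]; first by move=> d; rewrite !inE => /or3P[]/eqP->.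
by rewrite matching_hitting // cards0.
Qed.

(** Let c1 >= c2 count the common vertices of the parts. If c1 is 1 or 2, a non-common vertex of the
    first part has low degree. If c1 = 3, the first part is a single edge; then a suitable
    non-common vertex of the second part serves when c2 is 1 or 2, and a vertex of the single edge
    when c2 = 0. *)
Lemma decomposed_low_degree D1 D2 : decomposition E D1 D2 ->
  #|cover D1| + #|cover D2| = #|W| -> #|common D2| <= #|common D1| -> 0 < #|common D1| ->
  exists2 w, w \in W & degree E w <= #|W| - 2.
Proof.
move=> dec VW c21 c1.
have dec' := decomposition_sym dec.
have inW1 := subsetP (cover_subW EW dec); have inW2 := subsetP (cover_subW EW dec').
have c13 := card_common EW dec.
have n2 : 3 <= #|cover D2|.
  have /set0Pn[d dD] := dec_ne2 dec.
  rewrite -(dec_card2 EW dec dD); apply/subset_leq_card/subsetP => x xd.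
  by apply/coverP; exists d.
have [c1e3|c1n3] := eqVneq #|common D1| 3; last first.
  have c12 : #|common D1| <= 2 by lia.
  have [u u1 uC] := exists_noncommon EW dec c12.
  exists u; first exact: inW1.
  apply: leq_trans (degree_inside EW dec u1 uC) _.
  have p3 := card_covering_partners EW dec uC.
  (* For c1 = 2 the degree is at most 1 + 3 * 2 = 7. For c1 = 1 it is at most [#|cover D1|] - 2 + 3
     * 1, and the first cover has at most n - 3 vertices. *)
  have [c1e2|c1e1] : #|common D1| = 2 \/ #|common D1| = 1 by lia.
    have := degree_two_common EW (dec_sub1 dec) c1e2 uC; nia.
  have := degree_one_common EW (dec_sub1 dec) _ u1 uC.
  by rewrite -card_gt0 c1 => /(_ isT); nia.
have [V1C D1C] := cover_common3 EW dec c1e3.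
have n2' : 8 <= #|cover D2| by move: VW; rewrite V1C c1e3; lia.
have [c2e3|c2n3] := eqVneq #|common D2| 3.
  by have [V2C _] := cover_common3 EW dec' c2e3; move: n2'; rewrite V2C c2e3.
have D23 d : d \in D2 -> #|d| = 3 := dec_card2 EW dec (d := d).
have [c2e0|c2n0] := eqVneq #|common D2| 0; last first.
  have C2n : common D2 != set0 by rewrite -card_gt0 lt0n.
  (* The general bound of three partners would allow 3 * 3 crossing edges, too many here. For this
     [u] the partners are common to [D2], so the degree is at most 1 + 2 * 3 for c2 = 2 and (n - 3)
     - 2 + 1 * 3 = n - 2 for c2 = 1. *)
  have [u /setDP[u2 uC] H] := star_low_cover D23 (dec_ne2 dec) C2n n2'.
  exists u; first exact: inW2.
  apply: leq_trans (degree_inside EW dec' u2 uC) _; rewrite c1e3.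
  have pC : #|covering_partners D2 u| <= #|common D2|.
    apply/subset_leq_card/subsetP => z; rewrite [in z \in covering_partners _ _]inE.
    by case/andP => _ /forall_inP/H.
  have [c2e2|c2e1] : #|common D2| = 2 \/ #|common D2| = 1 by lia.
    have := degree_two_common EW (dec_sub2 dec) c2e2 uC; nia.
  have := degree_one_common EW (dec_sub2 dec) C2n u2 uC.
  by move: VW; rewrite V1C c1e3; nia.
have C20 : common D2 = set0 by apply/eqP; rewrite -cards_eq0 c2e0.
have [u uC] : exists u, u \in common D1 by apply/card_gt0P.
exists u; first by apply: inW1; rewrite V1C.
have [|s sD few] := few_hitting_pairs D23 C20; first by lia.
(* One for the single edge of [D1], and seven for the other edges through [u], whose remaining pairs
   hit all of [D2]. *)
apply: (@leq_trans 8); last by lia.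
apply: leq_trans (degree_split E D1 u) _; rewrite -(leq_add2l 1) in few.
apply: leq_trans few; apply: leq_add.
  rewrite -(cards1 (common D1)) -D1C; apply/subset_leq_card/subsetP => e.
  by rewrite inE => /andP[].
apply: degree_hitting => [|e d /setDP[eE e1] ue ds]; first exact: subsetDl.
have u2 : u \notin cover D2.
  by apply/negP => u2; have := in_set0 u; rewrite -(cover_disjoint dec) inE V1C uC u2.
split; last by apply: contra u2 => ud; apply/coverP; exists d; rewrite // sD.
by apply: dec_meet dec _ eE e1 (notin_dec ue u2) _ _; rewrite sD ?orbT.
Qed.

End ExistsLowDegree.

(** * Starplus graphs *)

Lemma bin2_double m : 2 * 'C(m, 2) = m * m.-1.
Proof. by elim: m => // m IH; rewrite binS bin1 /= mulnDr IH; case: m {IH} => //= m; nia. Qed.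

(** For a fixed sum the left side is convex, so its extreme case has one part of three vertices; for
    the sum 11 it is then 42 against 45. *)
Lemma bin2_split a b : 3 <= a -> 3 <= b -> 11 <= a + b ->
  ('C(a.-1, 2) + 10) + ('C(b.-1, 2) + 10) <= 'C((a + b).-1, 2).
Proof.
case: a b => [|a] [|b] //= a3 b3 ab.
have := bin2_double a; have := bin2_double b; have := bin2_double (a + b.+1).
by rewrite addnS /=; case: a a3 ab => // a; case: b b3 => // b /=; nia.
Qed.

(** Equality at m = 6, where 20 = 10 + 10, is the origin of the constant 10. *)
Lemma bin3_le_bin2 m : 0 < m <= 6 -> 'C(m, 3) <= 'C(m.-1, 2) + 10.
Proof. by case: m => [|[|[|[|[|[|[|m]]]]]]]. Qed.

Section Starplus.
Variable V : finType.
Implicit Types (W e : {set V}) (E : {set {set V}}).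

Lemma card_triples_in W : #|triples_in W| = 'C(#|W|, 3).
Proof. by rewrite -cards_draws; apply: eq_card => e; rewrite !inE andbC. Qed.

Definition full_star W v := [set e in triples_in W | v \in e].

Lemma card_full_star W v : v \in W -> #|full_star W v| = 'C(#|W|.-1, 2).
Proof.
move=> vW; have cW := cardsD1 v W; rewrite vW in cW.
have := cardsID (full_star W v) (triples_in W).
have -> : triples_in W :&: full_star W v = full_star W v.
  by apply/setIidPr/subsetP => e; rewrite inE => /andP[].
have -> : triples_in W :\: full_star W v = triples_in (W :\ v).
  by apply/setP => e; rewrite !inE subsetD1; case: (_ == _); case: (_ \subset _); rewrite ?andbF ?andbT.
by rewrite !card_triples_in cW /= binS [RHS]addnC => /addIn.
Qed.

Definition is_starplus W E := exists v e0,
  [/\ v \in W, e0 \in triples_in (W :\ v) & E = e0 |: full_star W v].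

Lemma card_starplus W E : is_starplus W E -> #|E| = ('C(#|W|.-1, 2)).+1.
Proof.
move=> [v [e0 [vW + ->]]]; rewrite inE subsetD1 => /and3P[_ _ ve].
by rewrite cardsU1 card_full_star // !inE (negbTE ve) andbF.
Qed.

Lemma place_triple n W (x0 : V) s c : labelling n W s -> c \in all_triples n ->
  place x0 s c \in triples_in W.
Proof.
move=> [us sn sW] cn; have := allP (wf_all_triples n) c cn.
move: cn; rewrite mem_filter => /andP[+ /allpairsP[[[i j] k] [_ _ ec]]].
rewrite ec /= andbT => /andP[ij jk] /and4P[li lj lk _].
have wn m : m < n -> nth x0 s m \in W by move=> lm; rewrite -sW mem_nth // sn.
rewrite inE; apply/andP; split; last first.
  by apply/subsetP => x; rewrite !inE => /or3P[]/eqP->; apply: wn.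
rewrite /place cardsE; apply/eqP/card_uniqP.
by rewrite /= !inE !nth_uniq ?sn //; lia.
Qed.

Lemma models_starplus n W E (x0 : V) s : 4 <= n ->
  labelling n W s -> models x0 E s (starplus_triples n) -> is_starplus W E.
Proof.
move=> n4 lab mE; have [us sn sW] := lab.
have in0 c : c \in all_triples n -> (nth x0 s 0 \in place x0 s c) = (0 \in c).
  move=> cn; have /allP wc := allP (wf_all_triples n) c cn.
  apply/placeP/idP => [[i ic /eqP]|]; last by exists 0.
  by rewrite nth_uniq ?sn ?(wc i) //; [move/eqP->| lia].
have n123 : [:: 1; 2; 3] \in all_triples n.
  rewrite mem_filter /=; apply/allpairsP; exists ((1, 2), 3).
  by rewrite allpairs_f // ?mem_iota //=; lia.
exists (nth x0 s 0), (place x0 s [:: 1; 2; 3]); split.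
- by rewrite -sW mem_nth // sn; lia.
- have := place_triple x0 lab n123; rewrite !inE subsetD1 => /andP[-> ->] /=.
  by have := in0 _ n123; rewrite inE => ->.
apply/setP => e; rewrite mE in_setU1 [e \in full_star _ _]inE.
apply/mapP/orP => [[c]|[/eqP->|/andP[eW e0]]].
- rewrite mem_filter => /andP[+ cn] ->; rewrite (place_triple x0 lab cn) in0 //.
  by case/orP => [->|/eqP->]; [right | left].
- by exists [:: 1; 2; 3]; rewrite // mem_filter eqxx orbT.
have /mapP[c cn ec] : e \in map (place x0 s) (all_triples n).
  by move: eW; rewrite inE => /andP[/eqP e3 eW]; apply: all_triplesP lab eW e3.
by exists c; rewrite // mem_filter cn -in0 // -ec e0.
Qed.

(** An edge through [w] that misses the centre [v] would form a path with [e0] and two star edges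
    avoiding [w]. Hence [E] lies in the starplus on [W] with the same [v] and [e0], and its size
    makes the inclusion an equality. *)
Lemma starplus_extend W E w : 11 <= #|W| -> w \in W -> E \subset triples_in W -> P4free E ->
  'C(#|W|.-1, 2) < #|E| -> is_starplus (W :\ w) [set e in E | w \notin e] -> is_starplus W E.
Proof.
move=> W11 wW EW F big [v [e0 [vW e0W EE]]].
have [vw vinW] : v != w /\ v \in W by move: vW; rewrite !inE => /andP.
move: e0W; rewrite inE => /andP[e03]; rewrite !subsetD1 -!andbA => /and3P[e0W we0 ve0].
have inE' e : e \in e0 |: full_star (W :\ w) v -> e \in E by rewrite -EE inE => /andP[].
have e0E : e0 \in E by rewrite inE' // !inE eqxx.
have starE x y : x \in W -> y \in W -> x != w -> y != w -> x != v -> y != v -> x != y ->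
    [set v; x; y] \in E.
  move=> xW yW xw yw xv yv xy; apply: inE'; rewrite !inE eqxx /= andbT.
  rewrite (_ : #|_| = 3) ?eqxx /=; last first.
    by rewrite -setUA cardsU1 cards2 xy !inE negb_or ![v == _]eq_sym xv yv.
  by rewrite !subUset !sub1set !inE vw vinW xw xW yw yW orbT.
have wE e : e \in E -> w \in e -> v \in e.
  move=> eE we; apply/negPn/negP => ve.
  have [e3 eW] := triples_inP EW eE.
  have outW x : x \in e -> x != w -> x \in W /\ x != v.
    by move=> xe xw; rewrite (subsetP eW) //; split=> //; apply: contraNneq ve => <-.
  have out0 x : x \in e0 -> [/\ x \in W, x != w & x != v].
    move=> x0; rewrite (subsetP e0W) //.
    by split=> //; [apply: contraNneq we0 | apply: contraNneq ve0] => <-.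
  (* If [e] = {w,x,y} is disjoint from [e0], the path is e0, {v,p,q}, {v,x,y}, e with p and q in
     [e0]. *)
  have [ee0|ee0] := boolP (meets e e0); last first.
    have /cards2P[x [y [xy exy]]] : #|e :\ w| == 2 by rewrite triple_pair.
    have [xe xw] : x \in e /\ x != w.
      by have : x \in e :\ w by [rewrite exy !inE eqxx]; rewrite inE => /andP[] /[!inE].
    have [ye yw] : y \in e /\ y != w.
      by have : y \in e :\ w by [rewrite exy !inE eqxx orbT]; rewrite inE => /andP[] /[!inE].
    have /card_gt1P[p [q [pe0 qe0 pq]]] : 1 < #|e0| by rewrite (eqP e03).
    have [[xW xv] [yW yv]] := (outW x xe xw, outW y ye yw).
    have [[pW pw pv] [qW qw qv]] := (out0 p pe0, out0 q qe0).
    have dis z : z \in e -> z \notin e0.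
      by move=> ze; apply: contra ee0 => z0; apply/meetsP; exists z.
    have /negP[] := F _ _ _ _ e0E (starE p q pW qW pw qw pv qv pq)
      (starE x y xW yW xw yw xv yv xy) eE.
    rewrite /path4 (meetsC e0 e) ee0 /=.
    apply/and5P; split.
    + by apply/meetsP; exists p; rewrite // !inE eqxx orbT.
    + by apply/meetsP; exists v; rewrite !inE eqxx.
    + by apply/meetsP; exists x; rewrite // !inE eqxx orbT.
    + apply/negP => /meetsP[z z0]; rewrite !inE -orbA => /or3P[]/eqP ez; subst z.
      * by rewrite z0 in ve0.
      * by have := dis x xe; rewrite z0.
      * by have := dis y ye; rewrite z0.
    apply/negP => /meetsP[z + ze]; rewrite !inE -orbA => /or3P[]/eqP ez; subst z.
    + by rewrite ze in ve.
    + by have := dis p ze; rewrite pe0.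
    + by have := dis q ze; rewrite qe0.
  (* If [e] meets [e0], the path is e, e0, {v,p,r}, {v,r,r'} with p in [e0] outside [e]. The
     vertices r and r' avoid v, [e0] and [e], which occupy at most 1 + 3 + 3 of the at least 11
     vertices. *)
  have [p pe0 pe] : exists2 p, p \in e0 & p \notin e.
    apply/subsetPn/negP => se; have /eqP ee : e0 == e by rewrite eqEcard se e3 (eqP e03).
    by rewrite ee we in we0.
  have [pW pw pv] := out0 p pe0.
  have X7 : #|v |: (e0 :|: e)| <= 7.
    rewrite cardsU1; apply: leq_trans (leq_add (leq_b1 _) (leq_card_setU _ _)) _.
    by rewrite (eqP e03) e3.
  have : 1 < #|W :\: (v |: (e0 :|: e))|.
    rewrite ltnNge; apply/negP => le1; move: W11; apply/negP; rewrite -ltnNge.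
    rewrite -(cardsID (v |: (e0 :|: e)) W) ltnS.
    apply: leq_trans (leq_add _ le1) (_ : 7 + 1 <= 10) => //.
    by rewrite (leq_trans _ X7) // subset_leq_card // subsetIr.
  case/card_gt1P => r [r' []]; rewrite !inE !negb_or => /andP[/and3P[rv r0 re] rW].
  case/andP => /and3P[r'v r'0 r'e] r'W rr'.
  have rw : r != w by apply: contraNneq re => ->.
  have r'w : r' != w by apply: contraNneq r'e => ->.
  have pr : p != r by apply: contraNneq r0 => <-.
  have /negP[] := F _ _ _ _ eE e0E (starE p r pW rW pw rw pv rv pr)
    (starE r r' rW r'W rw r'w rv r'v rr').
  rewrite /path4 ee0 /=; apply/and5P; split.
  + by apply/meetsP; exists p; rewrite // !inE eqxx orbT.
  + by apply/meetsP; exists v; rewrite !inE eqxx.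
  + apply/negP => /meetsP[z ze]; rewrite !inE -orbA => /or3P[]/eqP ez; subst z.
    * by rewrite ze in ve.
    * by rewrite ze in pe.
    * by rewrite ze in re.
  + apply/negP => /meetsP[z ze]; rewrite !inE -orbA => /or3P[]/eqP ez; subst z.
    * by rewrite ze in ve.
    * by rewrite ze in re.
    * by rewrite ze in r'e.
  apply/negP => /meetsP[z ze]; rewrite !inE -orbA => /or3P[]/eqP ez; subst z.
  * by rewrite ze in ve0.
  * by rewrite ze in r0.
  * by rewrite ze in r'0.
exists v, e0; split=> //; first by rewrite inE e03 subsetD1 e0W.
apply/eqP; rewrite eqEcard; apply/andP; split; last first.
  by rewrite cardsU1 card_full_star // !inE (negbTE ve0) andbF.
apply/subsetP => e eE; have [we|we] := boolP (w \in e).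
  by rewrite !inE (wE e eE we) andbT; have := subsetP EW e eE; rewrite inE => ->; rewrite orbT.
have : e \in e0 |: full_star (W :\ w) v by rewrite -EE inE eE.
rewrite !inE subsetD1 => /orP[->//|/andP[/and3P[-> -> _] ->]].
by rewrite orbT.
Qed.

End Starplus.

(** * Uniqueness of the starplus from 9 vertices on *)

Section Classification.
Variable V : finType.
Implicit Types (W e : {set V}) (E : {set {set V}}).

Lemma models_card (x0 : V) E s t : models x0 E s t -> #|E| <= size t.
Proof.
move=> mE; rewrite -(size_map (place x0 s)); apply: leq_trans (card_size _).
by apply/subset_leq_card/subsetP => e; rewrite mE.
Qed.

Lemma low_degree W E : E \subset triples_in W -> P4free E -> 11 <= #|W| ->
  (forall W' E', W' \proper W -> 0 < #|W'| -> E' \subset triples_in W' -> P4free E' ->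
     #|E'| <= 'C(#|W'|.-1, 2) + 10) ->
  'C(#|W|.-1, 2) < #|E| -> exists2 w, w \in W & degree E w <= #|W| - 2.
Proof.
move=> EW F W11 IH big.
have [/forall_inP I|] := boolP [forall d in E, forall e in E, meets d e].
  apply: intersecting_low_degree => // d e dE eE; exact: (forall_inP (I d dE)).
rewrite negb_forall_in => /exists_inP[a aE]; rewrite negb_forall_in => /exists_inP[b bE ab].
have an : a != set0 by rewrite -card_gt0 (triples_inP EW aE).1.
have [D1 [D2 dec]] := decomposition_exists F an aE bE ab.
have dec' := decomposition_sym dec.
(* A vertex outside both covers has degree at most 3 * 3 = 9, which is at most n - 2 exactly from n
   = 11 on. *)
have [/exists_inP[u uW /andP[u1 u2]]|none] :=
    boolP [exists u in W, (u \notin cover D1) && (u \notin cover D2)].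
  exists u => //; apply: leq_trans (degree_outside EW dec u1 u2) _.
  have := card_common EW dec; have := card_common EW dec'; nia.
have VW : #|cover D1| + #|cover D2| = #|W|.
  rewrite -cardsUI (cover_disjoint dec) cards0 addn0; apply: eq_card => x.
  rewrite inE; apply/orP/idP => [[]|xW].
  - exact: (subsetP (cover_subW EW dec)).
  - exact: (subsetP (cover_subW EW dec')).
  apply/orP; apply: contraNT none; rewrite negb_or => nx.
  by apply/exists_inP; exists x.
have [c1|c1] := posnP (#|common D1| + #|common D2|); last first.
  have [c21|/ltnW c12] := leqP #|common D2| #|common D1|.
    by apply: (decomposed_low_degree EW W11 dec VW c21); lia.
  by apply: (decomposed_low_degree EW W11 dec' _ c12); [rewrite addnC | lia].
have /eqP : #|common D1| + #|common D2| == 0 by rewrite c1.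
move=> /eqP; rewrite addn_eq0 !cards_eq0 => /andP[/eqP C1 /eqP C2].
(* Three vertices do not suffice for two in each cover, so an edge across would have a single vertex
   in one of them, and this vertex would be common to that part. *)
have Esub e : e \in E -> (e \in D1) || (e \in D2).
  move=> eE; apply/negPn; rewrite negb_or; apply/negP => /andP[e1 e2].
  have [e3 eW] := triples_inP EW eE.
  have [[x xe x1] [y ye y2]] := crossing_meets dec eE e1 e2.
  have ne1 : e :&: cover D1 != set0 by apply/set0Pn; exists x; rewrite inE xe.
  have ne2 : e :&: cover D2 != set0 by apply/set0Pn; exists y; rewrite inE ye.
  have le3 : #|e :&: cover D1| + #|e :&: cover D2| <= 3.
    rewrite -cardsUI -e3 setIACA (cover_disjoint dec) setI0 cards0 addn0.
    by rewrite subset_leq_card // -setIUr subsetIl.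
  have single (A : {set V}) z : z \in e :&: A -> #|e :&: A| <= 1 ->
      forall t, t \in e -> t \in A -> t = z.
    move=> zA c t te tA; have /cards1P[u eu] : #|e :&: A| == 1.
      by rewrite eqn_leq c card_gt0; apply/set0Pn; exists z.
    have : t \in e :&: A by rewrite inE te.
    by move: zA; rewrite eu !inE => /eqP-> /eqP->.
  have [l1|l1] := leqP #|e :&: cover D1| 1.
    have := crossing_single dec eE e1 e2 (single _ x _ l1); rewrite C1 inE xe x1.
    by move/(_ isT); rewrite in_set0.
  have l2 : #|e :&: cover D2| <= 1.
    by have := leq_trans (leq_add l1 (leqnn _)) le3; rewrite -[3]/(2 + 1) leq_add2l.
  have := crossing_single dec' eE e2 e1 (single _ y _ l2); rewrite C2 inE ye y2.
  by move/(_ isT); rewrite in_set0.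
(* The cover of one part misses the vertices of the other, so it is a proper subset of [W] and the
   induction hypothesis applies to it. *)
have bound D D' : decomposition E D D' -> #|D| <= 'C(#|cover D|.-1, 2) + 10 /\ 3 <= #|cover D|.
  move=> dc; have /set0Pn[d dD] := dec_ne1 dc; have /set0Pn[d' dD'] := dec_ne2 dc.
  have sub t : t \in D -> t \subset cover D by move=> tD; apply/subsetP => x xt; apply/coverP; exists t.
  have c3 : 3 <= #|cover D| by rewrite -(dec_card1 EW dc dD) subset_leq_card ?sub.
  split=> //; apply: IH; last exact: P4freeS (dec_sub1 dc) F.
  - rewrite properE (cover_subW EW dc) /=; apply/subsetPn.
    have /card_gt0P[y yd'] : 0 < #|d'| by rewrite (dec_card2 EW dc dD').
    have y2 : y \in cover D' by apply/coverP; exists d'.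
    exists y; first exact: (subsetP (cover_subW EW (decomposition_sym dc))).
    by apply/negP => y1; have := in_set0 y; rewrite -(cover_disjoint dc) inE y1 y2.
  - by lia.
  by apply/subsetP => t tD; rewrite inE (dec_card1 EW dc tD) sub.
have [b1 n1] := bound _ _ dec; have [b2 n2] := bound _ _ dec'.
have := bin2_split n1 n2; rewrite VW => /(_ W11).
have : #|E| <= #|D1| + #|D2|.
  apply: leq_trans (leq_card_setU _ _); apply/subset_leq_card/subsetP => e /Esub.
  by rewrite inE.
lia.
Qed.

(** Up to 6 vertices all triples are allowed, for 7 and 8 the search trees give 20 = 15 + 5 and 22 =
    21 + 1. The classification from 9 on is a hypothesis so that the bound can be used inside its
    own induction. *)
Lemma edge_bound_of m W E :
  (9 <= m -> forall W E, #|W| = m -> E \subset triples_in W -> P4free E ->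
     'C(m.-1, 2) < #|E| -> is_starplus W E) ->
  #|W| = m -> 0 < m -> E \subset triples_in W -> P4free E -> #|E| <= 'C(m.-1, 2) + 10.
Proof.
move=> H Wm m0 EW F.
have [m6|m7] := leqP m 6.
  apply: leq_trans (bin3_le_bin2 _); last by rewrite m0.
  by rewrite -Wm -card_triples_in subset_leq_card.
have [m9|m9] := leqP 9 m.
  have [small|big] := leqP #|E| 'C(m.-1, 2); first exact: leq_trans small (leq_addr _ _).
  by rewrite (card_starplus (H m9 W E Wm EW F big)) Wm -addn1 leq_add2l.
have [em|em] : m = 7 \/ m = 8 by lia.
  rewrite em (_ : 'C(_, 2) = 15) //; have [small|big] := ltnP #|E| 20; first by lia.
  rewrite em in Wm.
  have [x0 [s [t [_ + /models_card]]]] := certificate_sound (n := 7) (K := 20) isT isT check7 Wm EW F big.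
  by rewrite inE => /eqP-> sz; apply: leq_trans sz _; vm_compute.
rewrite em (_ : 'C(_, 2) = 21) //; have [small|big] := ltnP #|E| 22; first by lia.
rewrite em in Wm.
have [x0 [s [t [_ + /models_card]]]] := certificate_sound (n := 8) (K := 22) isT isT check8 Wm EW F big.
by rewrite !inE => /or3P[]/eqP-> sz; apply: leq_trans sz _; vm_compute.
Qed.

Theorem starplus_unique n : 9 <= n -> forall W E, #|W| = n -> E \subset triples_in W -> P4free E ->
  'C(n.-1, 2) < #|E| -> is_starplus W E.
Proof.
elim/ltn_ind: n => n IH n9 W E Wn EW F big.
have small m (W' : {set V}) (E' : {set {set V}}) : m < n -> #|W'| = m -> 0 < m ->
    E' \subset triples_in W' -> P4free E' -> #|E'| <= 'C(m.-1, 2) + 10.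
  by move=> mn; apply: edge_bound_of => m9; apply: IH.
have [en|[en|n11]] : n = 9 \/ n = 10 \/ 11 <= n by lia.
- rewrite en (_ : 'C(_, 2) = 28) // in Wn big.
  have [x0 [s [t [lab + mE]]]] := certificate_sound (n := 9) (K := 29) isT isT check9 Wn EW F big.
  by rewrite inE => /eqP te; apply: models_starplus lab _ => //; rewrite -te.
- rewrite en (_ : 'C(_, 2) = 36) // in Wn big.
  have [x0 [s [t [lab + mE]]]] := certificate_sound (n := 10) (K := 37) isT isT check10 Wn EW F big.
  by rewrite inE => /eqP te; apply: models_starplus lab _ => //; rewrite -te.
rewrite -Wn in n11 big.
have [|w wW dw] := low_degree EW F n11 _ big.
  move=> W' E' pW W'0 E'W; apply: small => //.
  by rewrite -Wn proper_card.
have cW := cardsD1 w W; rewrite wW in cW.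
apply: starplus_extend wW _ _ _ _ => //.
have EWw : [set e in E | w \notin e] \subset triples_in (W :\ w).
  apply/subsetP => e; rewrite !inE => /andP[/(triples_inP EW)[-> eW] we].
  by rewrite subsetD1 eW we.
apply: (IH #|W :\ w|) => //; [lia | lia | |].
  by apply: P4freeS F; apply/subsetP => e; rewrite inE => /andP[].
have cE : #|E| = degree E w + #|[set e in E | w \notin e]|.
  rewrite -(cardsID [set e in E | w \in e]); congr (_ + _); apply: eq_card => e; rewrite !inE.
    by case: (e \in E).
  by case: (e \in E); case: (w \in e).
(* The threshold drops by n - 2, which is also the bound on the degree of [w], so the remaining
   edges still exceed the threshold for n - 1. *)
have : 'C(#|W|.-1, 2) = 'C(#|W :\ w|.-1, 2) + #|W :\ w|.-1.
  by rewrite cW /= -[X in 'C(X, 2)]prednK ?binS ?bin1 //; lia.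
lia.
Qed.

End Classification.

(** * Isomorphisms and extremal numbers *)

(** In a path both [c] and [d] are disjoint from [a]. Within six vertices both are then the
    complement of [a], yet [b] meets only one of them. *)
Lemma P4free_small (V : finType) (W : {set V}) (E : {set {set V}}) :
  #|W| <= 6 -> E \subset triples_in W -> P4free E.
Proof.
move=> W6 EW a b c d aE bE cE dE; apply/negP => /and5P[_ bc _ ac /andP[ad bd]].
have [[a3 aW] [b3 bW]] := (triples_inP EW aE, triples_inP EW bE).
have [[c3 cW] [d3 dW]] := (triples_inP EW cE, triples_inP EW dE).
have co (e : {set V}) : e \subset W -> #|e| = 3 -> ~~ meets a e -> e = W :\: a.
  move=> eW e3 nae; apply/eqP; rewrite eqEcard e3 cardsD (setIidPr aW) a3 leq_subLR W6 andbT.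
  apply/subsetP => x xe; rewrite inE (subsetP eW) // andbT.
  by apply: contra nae => xa; apply/meetsP; exists x.
by move: bd; rewrite (co d) // -(co c) // bc.
Qed.

(** Of two disjoint edges one is [e0], but the three disjoint pairs ac, ad, bd of a path have no
    edge in common, and [e0] cannot occur in it twice. *)
Lemma P4free_starplus (V : finType) (W : {set V}) E : is_starplus W E -> P4free E.
Proof.
move=> [v [e0 [vW + ->]]]; rewrite inE => /andP[e03 _].
have mm : meets e0 e0.
  by rewrite /meets setIid -card_gt0 (eqP e03).
have dis a b : a \in e0 |: full_star W v -> b \in e0 |: full_star W v -> ~~ meets a b ->
    a = e0 \/ b = e0.
  rewrite !inE => /predU1P[->|/andP[_ va]]; first by left.
  case/predU1P=> [->|/andP[_ vb]]; first by right.
  by case/negP; apply/meetsP; exists v.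
move=> a b c d aE bE cE dE; apply/negP => /and5P[ab bc cd ac /andP[ad bd]].
case: (dis a c aE cE ac) => e1; case: (dis a d aE dE ad) => e2;
  case: (dis b d bE dE bd) => e3; subst.
- by rewrite bc in ac.
- by rewrite mm in ad.
- by rewrite bc in ac.
- by rewrite mm in ad.
- by rewrite mm in ac.
- by rewrite mm in ac.
- by rewrite mm in bd.
- by rewrite bc in bd.
Qed.

Section Isomorphism.
Variables (U V : finType) (G : graph3 U) (H : graph3 V).

Lemma iso3_P4free : iso3 G H -> P4free (edges H) -> P4free (edges G).
Proof.
move=> [f fB fE] F a b c d; rewrite !fE => aE bE cE dE.
by rewrite -(path4_imset _ _ _ _ (bij_inj fB)) F.
Qed.

Lemma iso3_card : iso3 G H -> #|U| = #|V| /\ #|edges G| = #|edges H|.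
Proof.
move=> [f fB fE]; split; first exact: bij_eq_card fB.
rewrite -(card_imset _ (imset_inj (bij_inj fB))); apply: eq_card => e.
apply/imsetP/idP => [[e' + ->]|eH]; first by rewrite fE.
have [g fK gK] := fB; exists (g @: e); last by rewrite -imset_comp (eq_imset _ gK) imset_id.
by rewrite fE -imset_comp (eq_imset _ gK) imset_id.
Qed.

Lemma models_iso n (x0 : U) (y0 : V) s s' t : labelling n [set: U] s -> labelling n [set: V] s' ->
  all (wf n) t -> models x0 (edges G) s t -> models y0 (edges H) s' t -> iso3 G H.
Proof.
move=> [us sn sU] [us' sn' sV] /allP wt mG mH.
have ins x : x \in s by rewrite sU inE.
have ins' x : x \in s' by rewrite sV inE.
pose f x := nth y0 s' (index x s); pose g y := nth x0 s (index y s').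
have fK : cancel f g.
  by move=> x; rewrite /f /g index_uniq ?nth_index // sn' -sn index_mem.
have gK : cancel g f.
  by move=> x; rewrite /f /g index_uniq ?nth_index // sn -sn' index_mem.
have fp c : wf n c -> f @: place x0 s c = place y0 s' c.
  move=> /allP wc; apply/setP => y; apply/imsetP/placeP => [[x /placeP[i ic ->] ->]|[i ic ->]].
    by exists i; rewrite // /f index_uniq // sn wc.
  by exists (nth x0 s i); [apply/placeP; exists i | rewrite /f index_uniq // sn wc].
exists f; first by exists g.
move=> e; rewrite mG mH; apply/mapP/mapP => [[c ct ->]|[c ct ec]]; exists c => //.
  by rewrite fp ?wt.
by apply: (imset_inj (can_inj fK)); rewrite ec fp ?wt.
Qed.
End Isomorphism.

Lemma card_bij (U V : finType) : #|U| = #|V| -> exists f : U -> V, bijective f.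
Proof.
move=> UV; exists (fun x => enum_val (cast_ord UV (enum_rank x))).
exists (fun y => enum_val (cast_ord (esym UV) (enum_rank y))) => x.
  by rewrite enum_valK cast_ordK enum_rankK.
by rewrite enum_valK cast_ordKV enum_rankK.
Qed.

(** The witness may live on any type with n elements; it is copied to ['I_n], where the maximum in
    [ex3] is taken. *)
Lemma ex3_eq n m (V : finType) (H : graph3 V) :
  (forall H : graph3 'I_n, P4free (edges H) -> #|edges H| <= m) ->
  #|V| = n -> P4free (edges H) -> #|edges H| = m -> ex3 n P4 = m.
Proof.
move=> ub Vn F Hm; apply/eqP; rewrite eqn_leq; apply/andP; split.
  by apply/bigmax_leqP => G /asboolP/free3P; apply: ub.
have [|f fB] := @card_bij 'I_n V; first by rewrite card_ord Vn.
pose G := graph3_of (fun e : {set 'I_n} => f @: e \in edges H).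
have GH : iso3 G H.
  exists f => // e; rewrite edgesE -(card_imset _ (bij_inj fB)) andb_idl //.
  by move/edges_card->.
have [_ cGH] := iso3_card GH.
rewrite -Hm -cGH; apply: (leq_bigmax_cond (F := fun H : graph3 'I_n => #|edges H|)).
by apply/asboolP/free3P; apply: iso3_P4free GH F.
Qed.

Lemma edges_triples_in (V : finType) (H : graph3 V) : edges H \subset triples_in [set: V].
Proof. by apply/subsetP => e eH; rewrite inE (edges_card eH) subsetT. Qed.

(** The frame for all four ranges of n. Upper bound and uniqueness come from one statement, that m
    or more edges force exactly m edges and membership in [X]; [H0] shows that m is attained. *)
Lemma extremal n m (X : forall V, graph3 V -> Prop) (V0 : finType) (H0 : graph3 V0) :
  #|V0| = n -> P4free (edges H0) -> #|edges H0| = m ->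
  (forall (V : finType) (H : graph3 V), #|V| = n -> P4free (edges H) -> m <= #|edges H| ->
     #|edges H| = m /\ X V H) ->
  (forall (V : finType) (H : graph3 V), X V H ->
     [/\ #|V| = n, P4free (edges H) & #|edges H| = m]) ->
  ex3 n P4 = m /\ forall (V : finType) (H : graph3 V), Ex3 n P4 H <-> X V H.
Proof.
move=> V0n F0 H0m up down.
have exm : ex3 n P4 = m.
  apply: (ex3_eq (H := H0)) => // H F; have [//|mH] := leqP #|edges H| m.
  by have [em _] := up _ H (card_ord n) F (ltnW mH); rewrite em ltnn in mH.
split=> // V H; split=> [[Vn /free3P F He]|XH].
  by have [] := up V H Vn F; rewrite ?He ?exm.
by have [Vn F He] := down V H XH; split; rewrite ?exm //; apply/free3P.
Qed.

Lemma iso3_transfer (U V : finType) (G : graph3 U) (H : graph3 V) n m :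
  #|V| = n -> P4free (edges H) -> #|edges H| = m -> iso3 G H ->
  [/\ #|U| = n, P4free (edges G) & #|edges G| = m].
Proof.
move=> Vn F Hm GH; have [UV EE] := iso3_card GH.
by split; [rewrite UV | apply: iso3_P4free GH F | rewrite EE].
Qed.

(** * 3-graphs described by explicit lists of triples *)

Section Models.
Variables (n : nat) (V : finType) (x0 : V) (s : seq V).
Hypothesis lab : labelling n [set: V] s.

Lemma mem_place c i : wf n c -> i < n -> (nth x0 s i \in place x0 s c) = (i \in c).
Proof.
have [us sn _] := lab; move=> /allP wc li.
apply/placeP/idP => [[j jc /eqP]|ic]; last by exists i.
by rewrite nth_uniq ?sn ?(wc j) // => /eqP->.
Qed.

Lemma place_inj : {in all_triples n &, injective (place x0 s)}.
Proof.
move=> c d cn dn cd; have wc := allP (wf_all_triples n) c cn.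
have wd := allP (wf_all_triples n) d dn.
move: cn dn; rewrite !mem_filter => /andP[sc _] /andP[sd _].
apply: (irr_sorted_eq ltn_trans ltnn) => // i.
have [li|li] := ltnP i n; first by rewrite -(mem_place wc) // cd mem_place.
by apply/idP/idP => [/(allP wc)|/(allP wd)]; rewrite ltnNge li.
Qed.

Lemma modelsP (H : graph3 V) (Q : pred (seq nat)) :
  {in all_triples n, forall c, (place x0 s c \in edges H) = Q c} ->
  models x0 (edges H) s [seq c <- all_triples n | Q c].
Proof.
move=> HQ e; apply/idP/mapP => [eH|[c]]; last first.
  by rewrite mem_filter => /andP[Qc cn] ->; rewrite HQ.
have /mapP[c cn ec] := all_triplesP x0 lab (subsetT e) (edges_card eH).
by exists c; rewrite // mem_filter cn -HQ // -ec eH.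
Qed.

Lemma models_size (E : {set {set V}}) t : models x0 E s t -> uniq t -> {subset t <= all_triples n} ->
  #|E| = size t.
Proof.
move=> mE ut tn; rewrite (eq_card mE) -(size_map (place x0 s)); apply/card_uniqP.
by rewrite map_inj_in_uniq // => c d /tn cn /tn dn; apply: place_inj.
Qed.

(** The nested filters drop unsuitable beginnings of a path early, which keeps the evaluation
    short. *)
Definition path_free t :=
  all (fun a => all (fun b => all (fun c => all (fun d => share a d || share b d)
    [seq d <- t | share c d]) [seq c <- t | share b c && ~~ share a c])
      [seq b <- t | share a b]) t.

Lemma P4free_models (E : {set {set V}}) t : models x0 E s t -> all (wf n) t -> path_free t -> P4free E.
Proof.
move=> mE /allP wt pf a b c d; rewrite !mE.
case/mapP=> a' ta ->; case/mapP=> b' tb ->; case/mapP=> c' tc ->; case/mapP=> d' td ->.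
rewrite /path4 !(meets_place x0 lab) ?wt //.
apply/negP => /and5P[ab bc cd ac]; apply/negP; rewrite -negb_or negbK.
have /allP pfa := allP pf a' ta.
have /pfa/allP pfb : b' \in [seq b <- t | share a' b] by rewrite mem_filter ab.
have /pfb/allP pfc : c' \in [seq c <- t | share b' c && ~~ share a' c].
  by rewrite mem_filter bc ac.
by apply: pfc; rewrite mem_filter cd.
Qed.
End Models.

Lemma starplus_models n (V : finType) (H : graph3 V) : 4 <= n -> #|V| = n ->
  is_starplus [set: V] (edges H) ->
  exists x0 s, labelling n [set: V] s /\ models x0 (edges H) s (starplus_triples n).
Proof.
move=> n4 Vn [v [e0 [_ + HE]]]; rewrite inE subsetD1 => /and3P[/eqP e03 _ ve0].
(* The centre receives label 0 and the extra edge the labels 1, 2, 3, as in [starplus_triples]. *)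
pose s := v :: enum e0 ++ enum (~: (v |: e0)).
have lab : labelling n [set: V] s.
  split.
  - rewrite /= mem_cat !mem_enum !inE eqxx (negbTE ve0) /= cat_uniq !enum_uniq andbT /=.
    by apply/hasPn => x; rewrite !mem_enum !inE negb_or => /andP[].
  - rewrite /= size_cat -!cardE e03 cardsCs setCK cardsU1 ve0 e03 Vn /=; lia.
  by move=> x; rewrite !(inE, mem_cat, mem_enum) orbA orbN.
have p123 : place v s [:: 1; 2; 3] = e0.
  apply/setP => x; rewrite inE -[x \in e0]mem_enum.
  have : size (enum e0) = 3 by rewrite -cardE.
  by rewrite /s; case: (enum e0) => [|? [|? [|? [|? ?]]]].
exists v, s; split=> //; apply: modelsP => // c cn.
have wc := allP (wf_all_triples n) c cn.
have n0 : 0 < n by lia.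
have n123 : [:: 1; 2; 3] \in all_triples n.
  rewrite mem_filter /=; apply/allpairsP; exists ((1, 2), 3).
  by rewrite allpairs_f // ?mem_iota //=; lia.
have v0 : (v \in place v s c) = (0 \in c) := mem_place v lab wc n0.
rewrite HE in_setU1 [_ \in full_star _ _]inE (place_triple v lab cn) v0 orbC.
by rewrite -p123 (inj_in_eq (place_inj lab)).
Qed.

Lemma is_starplus_starplus n : 4 <= n -> is_starplus [set: 'I_n] (edges (starplus n)).
Proof.
case: n => // n n4; pose e0 := [set x : 'I_n.+1 | 1 <= x <= 3].
have e03 : #|e0| = 3.
  have -> : e0 = [set inord 1; inord 2; inord 3].
    by apply/setP => x; rewrite !inE -!val_eqE /= !inordK; lia.
  by rewrite -setUA cardsU1 cards2 !inE -!val_eqE /= !inordK; lia.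
have ex0 (e : {set 'I_n.+1}) : [exists x in e, val x == 0] = (ord0 \in e).
  apply/exists_inP/idP => [[x xe /eqP x0]|oe]; last by exists ord0.
  by rewrite (_ : ord0 = x) //; apply: val_inj.
exists ord0, e0; split=> //; first by rewrite inE e03 subsetD1 subsetT inE.
apply/setP => e; rewrite edgesE [_ \in edges _]edgesE ex0 !inE subsetT andbT.
rewrite orbC andb_orr andbA andbb.
by rewrite andb_idl // => /eqP->; rewrite e03.
Qed.

(** * F-stars as lists of triples *)

Section FstarModels.
Variables (U : finType) (G : graph3 U) (u0 : U) (sU : seq U) (tU : seq (seq nat)) (n : nat).
Hypotheses (labU : labelling #|U| [set: U] sU) (Un : #|U| < n).
Hypotheses (GU : models u0 (edges G) sU tU) (tUn : {subset tU <= all_triples #|U|}).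

Let k := #|U|.
Let T : finType := option (U + 'I_(n - #|U| - 1)).

(** The distinguished vertex comes first, so the vertex of F labelled i in [sU] gets label i + 1
    here; hence the shift by [S] in [Fstar_models]. *)
Definition Fstar_labelling : seq T :=
  None :: map (Some \o inl) sU ++ map (Some \o inr) (enum 'I_(n - #|U| - 1)).

Lemma Fstar_labellingP : labelling n [set: T] Fstar_labelling.
Proof.
have [us sn sV] := labU; split.
- rewrite /= mem_cat cat_uniq; apply/and4P; split.
  + by rewrite negb_or; apply/andP; split; apply/mapP => -[].
  + by rewrite map_inj_uniq // => x y [].
  + by apply/hasPn => _ /mapP[x _ ->]; apply/mapP => -[].
  + by rewrite map_inj_uniq ?enum_uniq // => x y [].
- have arith i j : i < j -> (i + (j - i - 1)).+1 = j by lia.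
  by rewrite /= size_cat !size_map -enumT size_enum_ord sn arith.
case=> [[u|i]|]; rewrite !inE //= mem_cat; apply/orP; [left|right].
  by apply: (map_f (Some \o inl)); rewrite sV inE.
by apply: (map_f (Some \o inr)); rewrite mem_enum.
Qed.

Let nth_inl i : i < k -> nth None Fstar_labelling i.+1 = Some (inl (nth u0 sU i)).
Proof.
have [us sn sV] := labU; move=> ik.
by rewrite /= nth_cat size_map sn ik (nth_map u0) ?sn.
Qed.

Lemma Fstar_models : models None (edges (Fstar G n)) Fstar_labelling
  (Fstar_triples (map (map S) tU) k n).
Proof.
have lab := Fstar_labellingP; have [us sn sV] := labU.
apply: modelsP => // c cn; have wc := allP (wf_all_triples n) c cn.
have c3 : #|place None Fstar_labelling c| == 3.
  by have := place_triple None lab cn; rewrite inE => /andP[].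
rewrite edgesE c3 /=; congr (_ || _ && _).
- have shift d : d \in all_triples k -> map S d \in all_triples n /\
      [set Some (inl u) | u in place u0 sU d] = place None Fstar_labelling (map S d).
    move=> dk; have /allP wd := allP (wf_all_triples k) d dk; split.
      move: dk; rewrite !mem_filter => /andP[sd /allpairsP[[[i j] l] [/= _ _ ed]]].
      rewrite ed in sd wd *; rewrite /= in sd *.
      have := wd i; have := wd j; have := wd l; rewrite !inE !eqxx !orbT /=.
      move=> /(_ isT) lk /(_ isT) jk /(_ isT) ik; apply/andP; split; first by [].
      apply/allpairsP; exists ((i.+1, j.+1), l.+1).
      have lt m : m < k -> m.+1 < n by move=> mk; apply: leq_ltn_trans mk Un.
      by split=> //=; [apply: allpairs_f|]; rewrite mem_iota lt.
    apply/setP => x; apply/imsetP/placeP => [[u /placeP[i id ->] ->]|[_ /mapP[i id ->] ->]].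
      by exists i.+1; rewrite ?map_f // nth_inl ?wd.
    by exists (nth u0 sU i); [apply/placeP; exists i | rewrite nth_inl ?wd].
  apply/imsetP/mapP => [[f]|[d dt ->]].
    rewrite GU => /mapP[d dt ->] eq; exists d => //.
    have [dn pd] := shift d (tUn dt).
    by apply: (place_inj (x0 := None) lab) => //; rewrite eq pd.
  have [dn pd] := shift d (tUn dt).
  by exists (place u0 sU d); rewrite ?pd // GU map_f.
- by rewrite -(mem_place None lab wc) //; lia.
apply/existsP/hasP => [[u]|[i ic /andP[i0 ik]]].
  have uk : index u sU < k by rewrite -[k]sn index_mem sV inE.
  have -> : Some (inl u) = nth None Fstar_labelling (index u sU).+1.
    by rewrite nth_inl ?nth_index // sV inE.
  by rewrite (mem_place None lab wc) => [ic|]; [exists (index u sU).+1 | lia].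
exists (nth u0 sU i.-1); rewrite -nth_inl; last by lia.
by rewrite prednK // (mem_place None lab wc) // (allP wc).
Qed.

End FstarModels.

Lemma edges_complete3 n : edges (complete3 n) = triples_in [set: 'I_n].
Proof. by apply/setP => e; rewrite edgesE [RHS]inE subsetT. Qed.

Lemma labelling_ord n : labelling n [set: 'I_n] (enum 'I_n).
Proof. by split; [exact: enum_uniq | exact: size_enum_ord | move=> i; rewrite mem_enum !inE]. Qed.

Lemma complete3_models n (x0 : 'I_n) :
  models x0 (edges (complete3 n)) (enum 'I_n) (all_triples n).
Proof.
rewrite -[all_triples n]filter_predT; apply: (modelsP (labelling_ord n)) => c cn.
by rewrite edges_complete3 (place_triple x0 (labelling_ord n) cn).
Qed.

(** * Extremal numbers and extremal 3-graphs in the four ranges of n *)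

Lemma extremal_small n : n <= 6 ->
  ex3 n P4 = 'C(n, 3) /\
  forall (V : finType) (H : graph3 V), Ex3 n P4 H <-> iso3 H (complete3 n).
Proof.
move=> n6; have cO := card_ord n.
have FO : P4free (edges (complete3 n)).
  by apply: (@P4free_small _ [set: 'I_n]); rewrite ?cardsT ?card_ord // edges_triples_in.
have EO : #|edges (complete3 n)| = 'C(n, 3).
  by rewrite edges_complete3 card_triples_in cardsT card_ord.
apply: (extremal (X := fun V H => iso3 H (complete3 n)) cO FO EO) => V H; last first.
  exact: iso3_transfer cO FO EO.
move=> Vn F mH.
have HE : edges H = triples_in [set: V].
  by apply/eqP; rewrite eqEcard edges_triples_in card_triples_in cardsT Vn.
split; first by rewrite HE card_triples_in cardsT Vn.
have [|f fB] := @card_bij V 'I_n; first by rewrite card_ord.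
exists f => // e.
by rewrite edges_complete3 HE !inE !subsetT (card_imset _ (bij_inj fB)).
Qed.

(** The isolated vertex comes last, so the triples of the other vertices keep their labels. *)
Definition add_isolated_labelling n : seq (option 'I_n) := rcons (map Some (enum 'I_n)) None.

Lemma add_isolated_labellingP n :
  labelling n.+1 [set: option 'I_n] (add_isolated_labelling n).
Proof.
split; last 1 first.
- case=> [i|]; rewrite mem_rcons !inE //=.
  by rewrite mem_map ?mem_enum // => x y [].
- rewrite rcons_uniq map_inj_uniq ?enum_uniq ?andbT; last by move=> x y [].
  by apply/mapP => -[].
by rewrite size_rcons size_map size_enum_ord.
Qed.

Lemma add_isolated_models n (x0 : 'I_n) :
  models None (edges (add_isolated (complete3 n))) (add_isolated_labelling n) (all_triples n).
Proof.
have shift c : wf n c ->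
    place None (add_isolated_labelling n) c = Some @: place x0 (enum 'I_n) c.
  move=> /allP wc.
  have nthS i : i < n -> nth None (add_isolated_labelling n) i = Some (nth x0 (enum 'I_n) i).
    by move=> ni; rewrite nth_rcons size_map size_enum_ord ni (nth_map x0) ?size_enum_ord.
  apply/setP => x; apply/placeP/imsetP => [[i ic ->]|[_ /placeP[i ic ->] ->]].
    by exists (nth x0 (enum 'I_n) i); [apply/placeP; exists i | rewrite nthS ?wc].
  by exists i; rewrite ?nthS ?wc.
move=> e; apply/imsetP/mapP => [[f]|[c cn ->]].
  rewrite (complete3_models x0) => /mapP[c cn ->] ->; exists c => //.
  by rewrite shift // (allP (wf_all_triples n)).
exists (place x0 (enum 'I_n) c); last by rewrite shift // (allP (wf_all_triples n)).
by rewrite (complete3_models x0) map_f.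
Qed.

Lemma extremal7 :
  ex3 7 P4 = 20 /\
  forall (V : finType) (H : graph3 V), Ex3 7 P4 H <-> iso3 H (add_isolated (complete3 6)).
Proof.
set H0 := add_isolated _.
have m0 : models None (edges H0) _ _ := add_isolated_models (ord0 : 'I_6).
have c0 : #|{: option 'I_6}| = 7 by rewrite card_option card_ord.
have W0 : #|[set: option 'I_6] :\ None| = 6 by have := cardsD1 None [set: option 'I_6]; rewrite cardsT c0 inE => -[].
have F0 : P4free (edges H0).
  (* All edges lie on the six vertices other than the isolated one. *)
  apply: (@P4free_small _ ([set: option 'I_6] :\ None)); first by rewrite W0.
  apply/subsetP => e eH; rewrite inE (edges_card eH) eqxx subsetD1 subsetT /=.
  by move: eH => /imsetP[f _ ->]; apply/imsetP => -[].
have E0 : #|edges H0| = 20.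
  rewrite card_imset; last exact/imset_inj/Some_inj.
  by rewrite edges_complete3 card_triples_in cardsT card_ord.
apply: (extremal (X := fun V H => iso3 H H0) c0 F0 E0) => V H; last first.
  exact: iso3_transfer c0 F0 E0.
move=> Vn F mH.
have Wn : #|[set: V]| = 7 by rewrite cardsT.
have [x0 [s [t [lab + mE]]]] := certificate_sound (n := 7) (K := 20) isT isT check7 Wn
  (edges_triples_in H) F mH.
rewrite inE => /eqP te; rewrite te in mE.
have uniqt : uniq clique_plus_point by vm_compute.
have /allP subt : all (mem (all_triples 7)) clique_plus_point by vm_compute.
have sizet : size clique_plus_point = 20 by vm_compute.
split; first by rewrite (models_size lab mE uniqt subt).
apply: (models_iso lab (add_isolated_labellingP 6) _ mE m0).
by apply/allP => c /subt; apply/allP/wf_all_triples.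
Qed.

Lemma starplus_transfer n (V : finType) (H : graph3 V) : 4 <= n -> #|V| = n ->
  is_starplus [set: V] (edges H) -> iso3 H (starplus n).
Proof.
move=> n4 Vn sH.
have [x0 [s [lab mH]]] := starplus_models n4 Vn sH.
have [y0 [s' [lab' mS]]] := starplus_models n4 (card_ord n) (is_starplus_starplus n4).
apply: models_iso lab lab' _ mH mS.
by apply/allP => c; rewrite mem_filter => /andP[_]; apply/allP/wf_all_triples.
Qed.

Lemma starplus_extremal n : 4 <= n ->
  [/\ #|'I_n| = n, P4free (edges (starplus n)) & #|edges (starplus n)| = ('C(n.-1, 2)).+1].
Proof.
move=> n4; have sp := is_starplus_starplus n4; split; first exact: card_ord.
  exact: P4free_starplus sp.
by rewrite (card_starplus sp) cardsT card_ord.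
Qed.

Lemma SP_models : exists x0 s, labelling 8 setT s /\ models x0 (edges (SP 8)) s SP_triples.
Proof.
have lab := labelling_ord 5.
have mP : models ord0 (edges P) (enum 'I_5) [:: [:: 0; 1; 2]; [:: 2; 3; 4]].
  have -> : [:: [:: 0; 1; 2]; [:: 2; 3; 4]] =
      [seq c <- all_triples 5 | (c == [:: 0; 1; 2]) || (c == [:: 2; 3; 4])] by vm_compute.
  have memP (Q : pred nat) d : wf 5 d -> (forall x : 'I_5, Q x = (val x \in d)) ->
      [set x : 'I_5 | Q x] = place ord0 (enum 'I_5) d.
    move=> wd Qd; apply/setP => x.
    by rewrite inE Qd -[x in RHS](nth_ord_enum ord0) (mem_place ord0 lab).
  apply: (modelsP lab) => c cn; rewrite edgesE.
  have -> : [set x : 'I_5 | x <= 2] = place ord0 (enum 'I_5) [:: 0; 1; 2].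
    by apply: (memP (fun x => x <= 2)) => // -[[|[|[|[|[|]]]]]].
  have -> : [set x : 'I_5 | 2 <= x] = place ord0 (enum 'I_5) [:: 2; 3; 4].
    by apply: (memP (fun x => 2 <= x)) => // -[[|[|[|[|[|]]]]]].
  rewrite !(inj_in_eq (place_inj lab)) //.
  by have := place_triple ord0 lab cn; rewrite inE => /andP[->].
exists None, (Fstar_labelling (enum 'I_5) 8).
have labU : labelling #|'I_5| [set: 'I_5] (enum 'I_5) by rewrite card_ord.
have lt8 : #|'I_5| < 8 by rewrite card_ord.
split; first exact: (Fstar_labellingP labU lt8).
rewrite (_ : SP_triples = Fstar_triples
  (map (map S) [:: [:: 0; 1; 2]; [:: 2; 3; 4]]) #|'I_5| 8); last by rewrite card_ord.
by apply: Fstar_models labU lt8 mP _; rewrite card_ord; apply/allP; vm_compute.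
Qed.

Lemma SK_models : exists x0 s, labelling 8 setT s /\ models x0 (edges (SK 8)) s SK_triples.
Proof.
have labU : labelling #|'I_4| [set: 'I_4] (enum 'I_4) by rewrite card_ord; apply: labelling_ord.
have lt8 : #|'I_4| < 8 by rewrite card_ord.
exists None, (Fstar_labelling (enum 'I_4) 8).
split; first exact: (Fstar_labellingP labU lt8).
rewrite (_ : SK_triples = Fstar_triples (map (map S) (all_triples 4)) #|'I_4| 8).
  by apply: Fstar_models labU lt8 (complete3_models ord0) _; rewrite card_ord.
by rewrite card_ord.
Qed.

(** For the three explicit lists the absence of paths and the count of 22 distinct triples are
    established by evaluation. *)
Lemma models_extremal8 (V : finType) (H : graph3 V) (x0 : V) s t :
  t \in [:: starplus_triples 8; SP_triples; SK_triples] ->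
  labelling 8 setT s -> models x0 (edges H) s t ->
  [/\ #|V| = 8, P4free (edges H) & #|edges H| = 22].
Proof.
move=> tT lab mH; have [us sn sV] := lab.
have /and4P[pf ut /eqP st tn] :
    [&& path_free t, uniq t, size t == 22 & all (mem (all_triples 8)) t].
  by move: t tT {mH}; apply/allP; vm_compute.
split.
- by rewrite -cardsT -(eq_card sV) -sn; apply/card_uniqP.
- apply: (P4free_models lab mH _ pf).
  by apply/allP => c /(allP tn); apply/allP/wf_all_triples.
by rewrite (models_size lab mH ut) // => c /(allP tn).
Qed.

Lemma extremal8 :
  ex3 8 P4 = 22 /\
  forall (V : finType) (H : graph3 V),
    Ex3 8 P4 H <-> [\/ iso3 H (starplus 8), iso3 H (SP 8) | iso3 H (SK 8)].
Proof.
have [x1 [s1 [lab1 m1]]] := SP_models; have [x2 [s2 [lab2 m2]]] := SK_models.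
have [c0 F0 E0] := @starplus_extremal 8 isT.
have in1 : SP_triples \in [:: starplus_triples 8; SP_triples; SK_triples].
  by rewrite !inE eqxx orbT.
have in2 : SK_triples \in [:: starplus_triples 8; SP_triples; SK_triples].
  by rewrite !inE eqxx !orbT.
have [c1 F1 E1] := models_extremal8 in1 lab1 m1.
have [c2 F2 E2] := models_extremal8 in2 lab2 m2.
apply: (extremal (X := fun V H => [\/ iso3 H (starplus 8), iso3 H (SP 8) | iso3 H (SK 8)])
  c0 F0 E0) => V H; last first.
  by case; [apply: iso3_transfer c0 F0 E0 | apply: iso3_transfer c1 F1 E1
           | apply: iso3_transfer c2 F2 E2].
move=> Vn F mH; have Wn : #|[set: V]| = 8 by rewrite cardsT.
have [x0 [s [t [lab tT mE]]]] := certificate_sound (n := 8) (K := 22) isT isT check8 Wn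
  (edges_triples_in H) F mH.
have [_ _ E22] := models_extremal8 tT lab mE; split=> //.
have wf8 Q : all (wf 8) [seq c <- all_triples 8 | Q c].
  by apply/allP => c; rewrite mem_filter => /andP[_]; apply/allP/wf_all_triples.
move: tT mE; rewrite !inE => /or3P[]/eqP-> mE.
- by constructor; apply: starplus_transfer => //; apply: models_starplus lab mE.
- by constructor 2; apply: models_iso lab lab1 (wf8 _) mE m1.
by constructor 3; apply: models_iso lab lab2 (wf8 _) mE m2.
Qed.

Lemma extremal_large n : 9 <= n ->
  ex3 n P4 = 'C(n.-1, 2) + 1 /\
  forall (V : finType) (H : graph3 V), Ex3 n P4 H <-> iso3 H (starplus n).
Proof.
move=> n9; have n4 : 4 <= n by lia.
have [c0 F0 E0] := starplus_extremal n4; rewrite addn1.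
apply: (extremal (X := fun V H => iso3 H (starplus n)) c0 F0 E0) => V H; last first.
  exact: iso3_transfer c0 F0 E0.
move=> Vn F mH.
have sp : is_starplus [set: V] (edges H).
  by apply: starplus_unique n9 _ _ _ (edges_triples_in H) F mH; rewrite cardsT.
by rewrite (card_starplus sp) cardsT Vn; split=> //; apply: starplus_transfer.
Qed.

Theorem theorem1p1 (n : nat) (n_ge1 : 1 <= n) :
  [/\ n <= 6 ->
        ex3 n P4 = 'C(n, 3) /\
        (forall (V : finType) (H : graph3 V),
           Ex3 n P4 H <-> iso3 H (complete3 n)),
      n = 7 ->
        ex3 n P4 = 20 /\
        (forall (V : finType) (H : graph3 V),
           Ex3 n P4 H <-> iso3 H (add_isolated (complete3 6))),
      n = 8 ->
        ex3 n P4 = 22 /\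
        (forall (V : finType) (H : graph3 V),
           Ex3 n P4 H <-> [\/ iso3 H (starplus 8), iso3 H (SP 8) | iso3 H (SK 8)])
    & 9 <= n ->
        ex3 n P4 = 'C(n.-1, 2) + 1 /\
        (forall (V : finType) (H : graph3 V),
           Ex3 n P4 H <-> iso3 H (starplus n))].
Proof.
split; [exact: extremal_small | move=> -> | move=> -> | exact: extremal_large].
  exact: extremal7.
exact: extremal8.
Qed.
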